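(* Suppose $D$ is a strong, dense, noneven digraph. Then $D$ allows symplectic pairs if and only if $D = W_4$, $D = C_4^*$, or $D$ is an extended caterpillar (all up to isomorphism).
   Context: Digraphs are finite, without loops and without parallel arcs (both arcs $(u,v)$ and $(v,u)$ may be present). The degree of a vertex is the sum of its indegree and its outdegree. A digraph is strong if for every ordered pair of vertices $(u,v)$ there is a directed path from $u$ to $v$. It is semi-complete if for each pair of distinct vertices $u,v$ at least one of the arcs $(u,v)$, $(v,u)$ is present. A digraph with $n$ vertices is dense if either it is semi-complete or every vertex has degree at least $n$. A digraph $D$ is noneven if one can assign a weight in $\{0,1\}$ to each arc so that no directed (simple) cycle of $D$, including cycles of length 2, has even total weight. For an undirected graph $G$, $G^*$ is the digraph on the same vertices obtained by replacing each edge $uv$ by the two arcs $(u,v)$, $(v,u)$; $C_4$ is the undirected 4-cycle. $W_4$ is the digraph on vertices $1,2,3,4$ with the eight arcs $(1,2),(2,3),(3,4),(4,1),(1,3),(3,1),(2,4),(4,2)$. Extended caterpillars: take a simple undirected path $x_1x_2\cdots x_k$, $k\ge 1$ (the backbone). With each $x_j$, $2\le j\le k-1$, associate a (possibly empty) finite set of new vertices, all adjacent to $x_j$ only; call the resulting tree $T$. The blossom of $x_j$ consists of $x_j$ and its associated new vertices (if any). Write $u>v$ if $u$ is in the blossom of $x_i$, $v$ is in the blossom of $x_j$ and $i>j$. The extended caterpillar is formed from $T^*$ by adding all arcs $(u,v)$ not already present with $u>v$, and exactly one arc between any two non-backbone vertices of the same blossom, chosen so that the non-backbone vertices of each blossom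 induce a transitive tournament. A sign pattern is a matrix $H$ with entries in $\{0,1,-1\}$; for a real matrix $A$ of the same size, $A\in Q(H)$ means $\operatorname{sgn}(A_{ij})=\operatorname{sgn}(H_{ij})$ for all $i,j$. An $n\times n$ sign pattern $H$ is negative-diagonal if $H_{ii}=-1$ for all $i$. The (unweighted) digraph of an $n\times n$ sign pattern $H$ has vertices $1,\dots,n$ and arc set $\{(i,j): i\ne j,\ H_{ij}\neq 0\}$. The sign pattern $H$ allows symplectic pairs if there are real matrices $A,B\in Q(H)$ with $A^TB=I$. A digraph $D$ allows symplectic pairs if at least one negative-diagonal sign pattern whose digraph is $D$ allows symplectic pairs. *)

(* Defs.v *)
From mathcomp Require Import all_boot all_order all_algebra.
From mathcomp Require Import reals.

Set Implicit Arguments.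
Unset Strict Implicit.
Unset Printing Implicit Defensive.

Import Order.TTheory GRing.Theory Num.Theory.

(** A digraph is an irreflexive relation on a finite type: [D u v] means that
    [(u, v)] is an arc.  Parallel arcs are excluded by the representation, loops
    by an explicit hypothesis [irreflexive D]. *)

Definition digraph_iso (V W : finType) (D : rel V) (E : rel W) : Prop :=
  exists2 f : V -> W, bijective f & forall u v, E (f u) (f v) = D u v.

Section Digraphs.
Variables (V : finType) (D : rel V).

Definition strong : Prop := forall u v, connect D u v.

Definition semicomplete : Prop := forall u v, u != v -> D u v || D v u.

Definition degree (v : V) : nat :=
  #|[set u | D u v]| + #|[set u | D v u]|.

Definition dense_digraph : Prop :=
  semicomplete \/ forall v, #|V| <= degree v.

(** Only the values of [w] on arcs of [D] matter. The empty sequence counts as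
    a cycle for [ucycle], hence the explicit exclusion; sequences of size 1 are
    never cycles of an irreflexive relation. *)
Definition noneven : Prop :=
  exists w : V -> V -> bool, forall c : seq V, c != [::] -> ucycle D c ->
    odd (\sum_(u <- c) w u (next c u)).

End Digraphs.

(** [G^*], where the undirected graph [G] is given by a relation listing each
    edge in at least one direction. *)
Definition star (V : finType) (G : rel V) : rel V := fun u v => G u v || G v u.

Definition C4 : rel 'I_4 := fun i j => j == ordS i.

(** Vertices [1, 2, 3, 4] are renumbered [0, 1, 2, 3]. *)
Definition W4 : rel 'I_4 := fun i j =>
  (val i, val j) \in [:: (0, 1); (1, 2); (2, 3); (3, 0);
                         (0, 2); (2, 0); (1, 3); (3, 1)].

Section Caterpillars.
(** [x] is the backbone, indexed from 0, and [b u] is the index of the blossom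
    containing [u]; the vertices outside [codom x] are the associated new
    vertices. *)
Variables (V : finType) (k : nat) (x : 'I_k -> V) (b : V -> 'I_k).

Definition caterpillar_tree : rel V := fun u v =>
  [&& u \in codom x, v \in codom x & val (b v) == (b u).+1]
  || ((u \notin codom x) && (v == x (b u))).

Definition blossom_leaves (j : 'I_k) : {set V} :=
  [set u | (u \notin codom x) && (b u == j)].

Definition extended_caterpillar_arc (t : rel V) : rel V := fun u v =>
  [|| star caterpillar_tree u v,
      b v < b u
    | [exists j, [&& u \in blossom_leaves j, v \in blossom_leaves j & t u v]]].

End Caterpillars.

Definition transitive_tournament_on (V : finType) (A : {set V}) (t : rel V) :
    Prop :=
  [/\ {in A, forall u, ~~ t u u},
      {in A &, forall u v, u != v -> t u v (+) t v u}
    & {in A & &, transitive t}].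

(** No isomorphism is needed here: [V] is arbitrary, so the predicate is closed
    under relabelling. The condition on [b u] says that only the interior
    backbone vertices have associated vertices. *)
Definition extended_caterpillar (V : finType) (D : rel V) : Prop :=
  exists (k : nat) (x : 'I_k -> V) (b : V -> 'I_k) (t : rel V),
    [/\ 0 < k,
        cancel x b,
        forall u, u \notin codom x -> 0 < b u /\ (b u).+1 < k,
        forall j, transitive_tournament_on (blossom_leaves x b j) t
      & D =2 extended_caterpillar_arc x b t].

Local Open Scope ring_scope.

Definition sign_pattern (m n : nat) (H : 'M[int]_(m, n)) : Prop :=
  forall i j, H i j \in [:: 0; 1; -1].

Definition qualitative_class (R : realType) (m n : nat) (H : 'M[int]_(m, n))
    (A : 'M[R]_(m, n)) : Prop :=
  forall i j, sgz (A i j) = sgz (H i j).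

Definition negative_diagonal (n : nat) (H : 'M[int]_n) : Prop :=
  forall i, H i i = -1.

Definition pattern_digraph (n : nat) (H : 'M[int]_n) : rel 'I_n :=
  fun i j => (i != j) && (H i j != 0).

Definition pattern_allows_symplectic_pairs (R : realType) (n : nat)
    (H : 'M[int]_n) : Prop :=
  exists A B : 'M[R]_n,
    [/\ qualitative_class H A, qualitative_class H B & A^T *m B = 1%:M].

(** The vertices of [pattern_digraph H] are [0, ..., n.-1], so "the digraph of
    [H] is [D]" is read up to a labelling of the vertices of [D]. *)
Definition allows_symplectic_pairs (R : realType) (V : finType) (D : rel V) :
    Prop :=
  exists H : 'M[int]_#|V|,
    [/\ sign_pattern H, negative_diagonal H,
        digraph_iso D (pattern_digraph H)
      & pattern_allows_symplectic_pairs R H].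

(* Main.v *)
Require Import Defs.
From mathcomp Require Import all_boot all_order all_algebra.
From mathcomp Require Import reals.
From mathcomp Require Import zify ring lra.

Set Implicit Arguments.
Unset Strict Implicit.
Unset Printing Implicit Defensive.

(** Let [D] be strong, dense and noneven, and suppose first that some vertex [y]
    has a single out-neighbour [p]. If [a b^T = 1] with [a] and [b] of the same sign
    pattern with digraph [D], then every row other than row [y] is orthogonal to a
    row supported on the columns [y] and [p]; its entries in these two columns are
    therefore proportional to a fixed vector, so that [v -> y] if and only if [v] is
    [p] or [v -> p]. With density this makes every other vertex an in-neighbour of [y]
    and of [p], and merging the two columns leaves a pair of matrices for [D - y]
    ([biorthogonal_delete]). Attaching such a [y] to an extended caterpillar gives an
    extended caterpillar ([caterpillar_extend]), while the two exceptional digraphs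
    have no vertex that could serve as [p]; hence an induction. Conversely the low end
    of the backbone of an extended caterpillar is such a [y]
    ([caterpillar_restrict]), and a Givens rotation in the plane of [y] and [p]
    extends an orthogonal matrix for [D - y] to one for [D] ([givens_extend]). The
    result is a product of rotations, one for each edge of the caterpillar tree, in
    the order in which the tree grows. For [W4] and [C4^*]
    one takes weighing matrices of order 4 and weight 3.

    It remains to see that [W4] and [C4^*] are the only strong, dense, noneven
    digraphs in which all outdegrees are at least 2 ([out2_exceptions]). Density is
    weakened to the condition [near]: a vertex [x] that is not adjacent to
    [s > 0] vertices lies on at least [s + 1] two-cycles. For the induction, one
    exceptional vertex [e] is exempt from it. Delete [e], take a strong component [K]
    without arcs to other components, and contract the rest of [D] into a suitable
    vertex of [K]: the result is smaller, noneven, strong, and again [near] with one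
    exception. By induction it has a vertex of outdegree 1 or is [W4] or [C4^*]. In the
    first case [D] has a vertex [y] with exactly two out-neighbours, one of which is
    [e]; the second case leads to the same or to a contradiction.

    The structure around such a [y] is explored with parities. Give the arcs weights
    that make all cycles odd; after switching, the arcs leaving [y] have weight 0 and
    the arcs entering [y] have weight 1, so that every simple path from [y] to an
    in-neighbour of [y] is even ([path_even]). Hence an arc [u -> t] between
    in-neighbours of [y] has weight 0 unless every path from [y] to [u] goes through
    [t], in other words unless [t] dominates [u] in the sense of flow graphs. The arcs
    of the first kind form no cycle, so in every set of in-neighbours some vertex
    sends arcs, within the set, to its dominators only ([last_in]). Such a vertex is
    on at most one two-cycle with a dominator, and [near] then makes it adjacent to
    (almost) all vertices, which produces explicit even cycles unless [D] is [W4] or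
    [C4^*]. The cases are those of the number of two-cycles through [y]: none
    ([no_partner_false]), one ([one_partner]) or two ([two_partners], and [not_all_in]
    if [y] is adjacent to all vertices). *)
(** * Parities of walks *)

Section Parity.
Variables (V : finType) (D : rel V).

Fixpoint parity (w : V -> V -> bool) (a : V) (s : seq V) : bool :=
  if s is b :: s' then w a b (+) parity w b s' else false.

Lemma parity_cat w a s1 s2 :
  parity w a (s1 ++ s2) = parity w a s1 (+) parity w (last a s1) s2.
Proof. by elim: s1 a => //= b s IH a; rewrite IH addbA. Qed.

Lemma parity_rcons w a s b :
  parity w a (rcons s b) = parity w a s (+) w (last a s) b.
Proof. by rewrite -cats1 parity_cat /= addbF. Qed.

(** A cycle is a closed walk [a, s, a] with a marked starting vertex, which makes it
    possible to add up parities by recursion. *)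
Definition odd_weighting (w : V -> V -> bool) : Prop :=
  forall a s, uniq (a :: s) -> path D a (rcons s a) -> parity w a (rcons s a).

Lemma sum_next (w : V -> V -> bool) a s : uniq (a :: s) ->
  odd (\sum_(u <- a :: s) w u (next (a :: s) u)) = parity w a (rcons s a).
Proof.
move=> Us; rewrite [next _]/next.
suff H b t : uniq (b :: t) ->
   odd (\sum_(u <- b :: t) w u (next_at u a b t)) = parity w b (rcons t a).
  exact: H.
elim: t b => [|c t IH] b; first by rewrite big_seq1 /= eqxx addbF oddb.
move=> /[dup] /= /andP[bn Ut] _; rewrite big_cons /= eqxx oddD.
rewrite -(IH c Ut); congr (_ (+) _); first by rewrite oddb.
congr odd; rewrite 2!big_seq; apply: eq_bigr => u ui /=.
by case: (u =P b) => // ub; case/negP: bn; rewrite -ub.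
Qed.

Lemma nonevenP : noneven D <-> exists w, odd_weighting w.
Proof.
split=> -[w Hw]; exists w.
  move=> a s Us Ps; rewrite -sum_next //; apply: Hw => //.
  by rewrite /ucycle /cycle Ps.
move=> [//|a s] _ /andP[Ps Us]; rewrite sum_next //; exact: Hw.
Qed.

(** Rotating a cycle does not change its parity, so a cycle through [y] may be
    assumed to start at [y]. *)
Lemma odd_weighting_rooted y w :
  (forall s, uniq (y :: s) -> path D y (rcons s y) -> parity w y (rcons s y)) ->
  (forall a s, y \notin a :: s -> uniq (a :: s) -> path D a (rcons s a) ->
    parity w a (rcons s a)) ->
  odd_weighting w.
Proof.
move=> Hy Hn a s Us Ps; have [|yn] := boolP (y \in a :: s); last exact: Hn.
rewrite inE => /predU1P[ya|ys]; first by subst a; exact: Hy.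
case/splitPr: ys Us Ps => s1 s2 Us Ps.
move: (Hy (s2 ++ a :: s1)).
have -> : uniq (y :: s2 ++ a :: s1) by rewrite -cat_cons uniq_catC.
move: Ps; rewrite rcons_cat /= cat_path /= rcons_path => /and4P[P1 P2 P3 P4].
rewrite rcons_cat /= cat_path /= P3 P4 rcons_path P1 P2 => /(_ isT isT).
rewrite !parity_cat /= !parity_rcons.
by do 2!case: (parity _ _ _); do 2!case: (w _ _).
Qed.

Lemma irreflexive_neq u v : irreflexive D -> D u v -> u != v.
Proof. by move=> irr; apply: contraTN => /eqP->; rewrite irr. Qed.

Definition out2 := forall x a, exists2 b, D x b & b != a.

Definition partners x : {set V} := [set u | D x u && D u x].
Definition strangers x : {set V} := [set u | [&& u != x, ~~ D x u & ~~ D u x]].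

(** Semi-complete digraphs satisfy this because there are no strangers, digraphs of
    large minimum degree because the degree of [x] is the number of vertices, minus
    one, minus the strangers, plus the partners. Unlike the degree condition it
    passes to the smaller digraphs of the induction. *)
Definition near x : bool := #|strangers x| <= #|partners x|.-1.

Lemma near_partner x s a : near x -> s \in strangers x ->
  exists2 c, c \in partners x & c != a.
Proof.
move=> nx sx.
have: 0 < #|partners x :\ a|.
  have := cardsD1 a (partners x); have: 0 < #|strangers x| by apply/card_gt0P; exists s.
  by move: nx; rewrite /near; case: (a \in _); lia.
by case/card_gt0P=> c; rewrite !inE => /andP[ca cP]; exists c; rewrite ?inE.
Qed.

Lemma near_partner2 x s1 s2 a b : near x -> s1 \in strangers x ->
  s2 \in strangers x -> s1 != s2 ->
  exists c, [/\ c \in partners x, c != a & c != b].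
Proof.
move=> nx s1x s2x s12.
have: 0 < #|partners x :\ a :\ b|.
  have: 1 < #|strangers x|.
    by rewrite (cardsD1 s1) s1x ltnS; apply/card_gt0P; exists s2; rewrite !inE eq_sym s12; rewrite !inE in s2x.
  have := cardsD1 a (partners x); have := cardsD1 b (partners x :\ a).
  by move: nx; rewrite /near; case: (a \in _); case: (b \in _); lia.
case/card_gt0P=> c; rewrite !inE => /and3P[cb ca cP].
by exists c; split; rewrite ?inE.
Qed.

(** A single two-cycle is never enough to compensate for a stranger. *)
Lemma near_adjacent x u : near x -> u != x ->
  (forall c c', c \in partners x -> c' \in partners x -> c = c') ->
  ~~ D x u -> D u x.
Proof.
move=> nx ux uniqP xu; apply/negPn/negP => ux'.
have su : u \in strangers x by rewrite !inE ux xu.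
have [c cP _] := near_partner x nx su.
by have [c' c'P /eqP] := near_partner c nx su; apply; apply: uniqP.
Qed.

End Parity.

(** * Dominators in a digraph with a root *)

(** Take a vertex that reaches as few vertices as possible. *)
Lemma sink_exists (V : finType) (r : rel V) (S : {set V}) (x : V) :
  x \in S ->
  (forall z t, z \in S -> t \in S -> r z t ->
     ~~ connect [rel a b | [&& a \in S, b \in S & r a b]] t z) ->
  exists2 z, z \in S & forall t, t \in S -> ~~ r z t.
Proof.
move=> xS acyc; set r' := [rel a b | _] in acyc.
case: (arg_minnP (fun z => #|connect r' z|) xS) => z zS' zmin.
have zS : z \in S by [].
exists z => // t tS; apply/negP => zt.
have /negP[] := acyc z t zS tS zt.
have zt' : connect r' z t by apply: connect1; rewrite /r' /= zS tS.
have sub : connect r' t \subset connect r' z.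
  by apply/subsetP => u; rewrite !inE; apply: connect_trans.
have : connect r' t =i connect r' z.
  by apply/subset_cardP => //; apply/eqP; rewrite eqn_leq zmin // subset_leq_card.
by move=> /(_ z); rewrite !inE connect0.
Qed.

Section Root.
Variables (V : finType) (D : rel V) (y : V).
Hypotheses (D_irr : irreflexive D) (D_strong : strong D).

(** The walks from the root [y] that avoid [d], for [d != y]. *)
Definition reach d u := connect [rel a b | D a b && (b != d)] y u.

(** The dominators of flow graphs: every path from [y] to [u] goes through [d]. *)
Definition dominates d u := [&& d != y, d != u & ~~ reach d u].

Lemma walk_avoid d a s : path D a s -> d \notin s ->
  connect [rel a b | D a b && (b != d)] a (last a s).
Proof.
move=> Ps ds; apply/connectP; exists s => //.
elim: s a ds Ps => //= b s IH a; rewrite inE negb_or => /andP[db ds].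
by case/andP=> -> /(IH _ ds) ->; rewrite eq_sym db.
Qed.

Lemma reach_walk d s : path D y s -> d \notin s -> reach d (last y s).
Proof. exact: walk_avoid. Qed.

Lemma reach_path d u : d != y -> reach d u ->
  exists s, [/\ path D y s, uniq (y :: s), last y s = u & d \notin s].
Proof.
move=> dy /connectP[s0 P0 ->]; case/shortenP: P0 => s Ps Us _; exists s.
have [Ps' ds] : path D y s /\ d \notin s.
  elim: s {1 2}y Ps {Us} => //= b s IH a /andP[/andP[ab bd] /IH[-> ds]].
  by rewrite ab inE negb_or eq_sym bd.
by split.
Qed.

Lemma root_path u : exists s, [/\ path D y s, uniq (y :: s) & last y s = u].
Proof.
have /connectP[s0 P0 ->] := D_strong y u.
by case/shortenP: P0 => s Ps Us _; exists s.
Qed.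

Lemma reach_step d u v : reach d u -> D u v -> v != d -> reach d v.
Proof. by move=> ru uv vd; apply: connect_trans ru (connect1 _); rewrite /= uv. Qed.

Lemma reach_root d q : D y q -> q != d -> reach d q.
Proof. by move=> yq qd; apply: connect1; rewrite /= yq. Qed.

Lemma not_dominates d u : d != y -> d != u -> ~~ dominates d u -> reach d u.
Proof. by rewrite /dominates => -> -> /negPn. Qed.

Lemma dominates_neq d u : dominates d u -> d != u.
Proof. by case/and3P. Qed.

(** The arc from the root to [q] meets no other vertex. *)
Lemma dominates_root d q : D y q -> dominates d q = false.
Proof.
move=> yq; apply/and3P => -[_ dq /negP[]]; apply: reach_root => //.
by rewrite eq_sym.
Qed.

Lemma dominates_y d : dominates d y = false.
Proof. by apply/and3P => -[_ _ /negP[]]; apply: connect0. Qed.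

(** Every predecessor of a dominated vertex is the dominator or is dominated
    by it, as otherwise the dominator could be by-passed. *)
Lemma dominates_pred d z u :
  dominates d z -> D u z -> u != d -> dominates d u.
Proof.
case/and3P=> dy dz nr uz ud; rewrite /dominates dy eq_sym ud.
by apply: contra nr => ru; apply: reach_step ru uz _; rewrite eq_sym.
Qed.

(** Cut a path from the root at the first of the two vertices. *)
Lemma dominates_asym a b : dominates a b -> dominates b a -> False.
Proof.
case/and3P=> ay ab /negP nab /and3P[b_y ba /negP nba].
have [s [Ps Us sa]] := root_path a.
have [bs|bs] := boolP (b \in s); last by apply: nba; rewrite -sa; apply: reach_walk.
have as_ : a \in s.
  by have := mem_last y s; rewrite sa inE (negbTE ay).
case/splitPr: bs Ps Us sa as_ => s1 s2; rewrite cat_path /= => /and3P[P1 P2 P3].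
rewrite last_cat /= => /andP[_ U] la _.
apply: nab; rewrite -(last_rcons y s1 b); apply: reach_walk.
  by rewrite rcons_path P1.
rewrite mem_rcons inE negb_or ab /=; apply/negP => a1.
move: U; rewrite cat_uniq => /and3P[_ /hasP[]]; exists a => //.
by rewrite -la mem_last.
Qed.

(** On a path from the root to [z], let one of the dominators [a] and [b] occur first:
    if the other one could be reached without it, so could [z]. *)
Lemma dominates_chain a b z : dominates a z -> dominates b z -> a != b ->
  dominates a b || dominates b a.
Proof.
move=> /and3P[ay az /negP naz] /and3P[b_y bz /negP nbz] ab.
have [s [Ps Us sz]] := root_path z.
have as_ : a \in s by apply/negPn/negP => n; apply: naz; rewrite -sz reach_walk.
have bs_ : b \in s by apply/negPn/negP => n; apply: nbz; rewrite -sz reach_walk.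
rewrite /dominates ay b_y ab eq_sym ab /= -negb_and; apply/negP => /andP[rb ra].
case/splitPr: as_ Ps Us sz bs_ => s1 s2; rewrite cat_path /= last_cat /=.
move=> /and3P[P1 P2 P3] /andP[_ U] la.
move: U; rewrite cat_uniq /= => /and4P[_ dis a2 _].
have [b2|b2 _] := boolP (b \in s2); last first.
  by apply: nbz; rewrite -la; apply: connect_trans ra (walk_avoid P3 b2).
case/splitPr: b2 P3 la a2 {dis} => t1 t2.
rewrite cat_path last_cat /= => /and3P[_ _ P3] la.
rewrite mem_cat inE !negb_or => /and3P[_ _ a2] _.
by apply: naz; rewrite -la; apply: connect_trans rb (walk_avoid P3 a2).
Qed.

(** Take the end of a path from the root to [x]: a vertex after [d] that could be
    reached without [d] would give a path to [x] without [d]. *)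
Lemma dominates_path d x : dominates d x ->
  exists s, [/\ path D d s, uniq (d :: s), last d s = x & all (dominates d) s].
Proof.
case/and3P=> dy dx /negP ndx; have [s [Ps Us sx]] := root_path x.
have ds : d \in s by apply/negPn/negP => n; apply: ndx; rewrite -sx reach_walk.
case/splitPr: ds Ps Us sx => s1 s2; rewrite cat_path last_cat.
move=> /= /and3P[_ _ P2] /andP[_]; rewrite cat_uniq => /and3P[_ _ U2] la.
exists s2; split=> //; apply/allP => u us; apply/and3P; split=> //.
  by apply: contraTneq us => <-; case/andP: U2.
apply/negP => ru; apply: ndx; case/splitPr: us P2 U2 la => t1 t2.
rewrite cat_path last_cat /= => /and3P[_ _ P2] /andP[].
rewrite mem_cat inE !negb_or => /and3P[_ _ d2] _ <-.
exact: connect_trans ru (walk_avoid P2 d2).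
Qed.

(** This is how dominators are found: a set containing the root can only be left
    through [p]. *)
Lemma dominates_entry (B : {set V}) p x : y \in B -> p \notin B ->
  (forall b u, b \in B -> D b u -> u \notin B -> u = p) ->
  x \notin B -> x != p -> dominates p x.
Proof.
move=> yB pB exitB xB xp; apply/and3P; split; rewrite 1?eq_sym //.
  by apply: contraNneq pB => <-.
apply/negP => /connectP[s Ps lx]; case/negP: xB; rewrite lx.
elim: s y yB Ps {lx} => //= b s IH a aB /andP[/andP[ab bp] Ps].
apply: IH Ps; apply/negPn/negP => nb.
by rewrite (exitB a b) ?eqxx in bp.
Qed.

Variable w : V -> V -> bool.
Hypotheses (w_odd : odd_weighting D w).
Hypotheses (w_out : forall q, D y q -> w y q = false).
Hypotheses (w_in : forall t, D t y -> w t y).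

(** The arc from the last vertex to the root, of weight 1, closes an odd cycle. *)
Lemma path_even s : path D y s -> uniq (y :: s) -> D (last y s) y ->
  parity w y s = false.
Proof.
move=> Ps Us ly; have := w_odd Us; rewrite rcons_path Ps ly => /(_ isT).
by rewrite parity_rcons w_in // addbT => /negbTE.
Qed.

(** Both a path to [u] that avoids [t] and its extension by the arc are even. *)
Lemma arc_even u t : D u t -> D u y -> D t y -> reach t u -> w u t = false.
Proof.
move=> ut uy ty ru; have ny : t != y by apply: irreflexive_neq ty.
have [s [Ps Us su ts]] := reach_path ny ru.
have := @path_even (rcons s t); rewrite rcons_path last_rcons parity_rcons su.
rewrite -rcons_cons rcons_uniq inE negb_or ny ts Us Ps ut ty => /(_ isT isT isT).
by rewrite (path_even Ps Us) ?su.
Qed.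

Lemma root_arc_even u t : D y u -> D u t -> D t y -> w u t = false.
Proof.
move=> yu ut ty; have /= := @path_even [:: u; t].
rewrite !inE negb_or yu ut ty (irreflexive_neq _ yu) //.
by rewrite (irreflexive_neq _ ut) // eq_sym (irreflexive_neq _ ty) // w_out // addbF => /(_ isT isT isT).
Qed.

(** By [arc_even] the arcs [u -> t] within [S] such that [t] does not dominate [u]
    have weight 0, so that they form no cycle; a sink for these arcs is a last vertex
    of [S]. *)
Lemma last_in (S : {set V}) x : x \in S -> (forall t, t \in S -> D t y) ->
  exists2 z, z \in S & forall t, t \in S -> D z t -> dominates t z.
Proof.
move=> xS Sy.
have [|z zS zmax] := @sink_exists _ [rel u t | D u t && reach t u] S x xS.
  move=> z t zS tS /andP[zt tz]; apply/negP => /connectP[s0 P0 ez].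
  case/shortenP: P0 ez => s Ps Us _ ez.
  have E : forall v s, v \in S -> path [rel a b | [&& a \in S, b \in S &
     [rel u t | D u t && reach t u] a b]] v s -> path D v s /\ parity w v s = false.
    move=> v s' vS; elim: s' v vS => //= b s' IH v _ /andP[/and4P[vS bS vb bv]].
    by case/(IH b bS) => -> ->; rewrite vb arc_even ?Sy.
  have [PD P0] := E _ _ tS Ps.
  have := w_odd Us; rewrite rcons_path PD -ez zt => /(_ isT).
  by rewrite parity_rcons P0 -ez arc_even ?Sy.
exists z => // t tS zt; have := zmax t tS; rewrite /= zt /= => nr.
by rewrite /dominates nr (irreflexive_neq D_irr (Sy t tS)) eq_sym (irreflexive_neq _ zt).
Qed.

(** The arcs [z -> m -> c] lie both on the cycle [z m c z], where the remaining weight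
    is 0, and on the cycle that goes from the root to [z] by the given path and
    returns from [c], where it is 1: one of these cycles is even. *)
Lemma no_detour z m c s : D z m -> D m c -> D c z -> D c y -> D z y -> w c z = false ->
  path D y s -> uniq (y :: s) -> last y s = z -> m != y -> c \notin s -> m \notin s ->
  False.
Proof.
move=> zm mc cz cy zy wcz Ps Us sz my cs ms.
have cm : c != m by rewrite eq_sym (irreflexive_neq D_irr mc).
have cyn : c != y by apply: irreflexive_neq cy.
have U : uniq (y :: s ++ [:: m; c]).
  rewrite -cat_cons cat_uniq Us /= !inE !negb_or my ms cyn cs.
  by rewrite eq_sym cm.
have := path_even _ U; rewrite cat_path last_cat /= sz Ps zm mc cy.
move=> /(_ isT isT); rewrite parity_cat (path_even Ps Us) ?sz //=.
have := @w_odd c [:: z; m]; rewrite /= !inE !negb_or cz zm mc cm.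
rewrite (irreflexive_neq D_irr cz) (irreflexive_neq D_irr zm) => /(_ isT isT).
by rewrite wcz /=; case: (w z m); case: (w m c).
Qed.

Lemma dominates_path_even p x : D y p -> dominates p x -> D x y ->
  exists s, [/\ path D p s, uniq (p :: s), last p s = x, all (dominates p) s
             & parity w p s = false].
Proof.
move=> yp px xy; have [s [Ps Us sx ds]] := dominates_path px.
have U : uniq (y :: p :: s).
  move: Us => /= ->; rewrite inE negb_or (irreflexive_neq _ yp) //= andbT.
  by apply/negP => /(allP ds); rewrite dominates_y.
by exists s; split=> //; have := path_even _ U; rewrite /= yp Ps sx w_out //=; apply.
Qed.

End Root.

(** * Adding an arc into the root *)
Lemma near_subrel (V : finType) (D D' : rel V) x :
  subrel D D' -> near D x -> near D' x.
Proof.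
move=> sub; rewrite /near => nx.
have SS : #|strangers D' x| <= #|strangers D x|.
  apply/subset_leq_card/subsetP => u; rewrite !inE => /and3P[-> a b] /=.
  by rewrite (contra (@sub _ _) a) (contra (@sub _ _) b).
have PP : #|partners D x| <= #|partners D' x|.
  by apply/subset_leq_card/subsetP => u; rewrite !inE => /andP[/sub-> /sub->].
lia.
Qed.

Lemma strong_subrel (V : finType) (D D' : rel V) :
  subrel D D' -> strong D -> strong D'.
Proof. by move=> sub sD u v; apply: connect_sub (sD u v) => a b /sub; apply: connect1. Qed.

(** Switching at a vertex, that is, changing the weights of all arcs at that vertex,
    keeps the parities of cycles. Switching at the neighbours of the root suffices;
    where there is a two-cycle, one of its arcs determines the other. *)
Lemma normalized_weighting (V : finType) (D : rel V) y w :
  irreflexive D -> odd_weighting D w ->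
  exists w', [/\ odd_weighting D w', forall q, D y q -> w' y q = false
               & forall t, D t y -> w' t y].
Proof.
move=> irr Hw.
pose f v := if v == y then false else if D v y then ~~ w v y else w y v.
pose w' u v := w u v (+) (f u (+) f v).
have E a s : parity w' a s = parity w a s (+) (f a (+) f (last a s)).
  elim: s a => [|b s IH] a /=; first by rewrite addbb.
  by rewrite IH /w'; case: (w a b); case: (parity w b s); case: (f a); case: (f b); case: (f _).
exists w'; split=> [a s Us Ps|q yq|t ty].
- by rewrite E last_rcons addbb addbF; apply: Hw.
- rewrite /w' /f eqxx [q == y]eq_sym (negbTE (irreflexive_neq irr yq)) /=.
  case: ifP => qy; last by rewrite addbb.
  have /= := Hw y [:: q]; rewrite inE yq qy (irreflexive_neq irr yq).
  by move=> /(_ isT isT); case: (w y q); case: (w q y).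
- by rewrite /w' /f eqxx (negbTE (irreflexive_neq irr ty)) ty addbF addbN addbb.
Qed.

Section Partner.
Variables (V : finType) (D : rel V) (y z : V).

(** Two such dominators would dominate each other, by [dominates_pred]. *)
Lemma dominating_pred_uniq c c' : dominates D y c z -> dominates D y c' z ->
  strong D -> D c z -> D c' z -> c = c'.
Proof.
move=> dc dc' sD cz c'z; apply/eqP; apply: contraT => cc'.
have [] := @dominates_asym _ D y sD c c'.
  by apply: dominates_pred dc c'z _; rewrite eq_sym.
exact: dominates_pred dc' cz _.
Qed.

(** By the chain property one of [q] and [q'] would dominate the other. *)
Lemma root_not_dominating q q' : strong D -> D y q -> D y q' -> q != q' ->
  ~~ dominates D y q z || ~~ dominates D y q' z.
Proof.
move=> sD yq yq' qq'; rewrite -negb_and; apply/negP => /andP[dq dq'].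
by have := dominates_chain sD dq dq' qq'; rewrite !dominates_root.
Qed.

Lemma dominating_not_root d : dominates D y d z -> ~~ D y z.
Proof. by move=> dz; apply/negP => yz; rewrite (dominates_root _ yz) in dz. Qed.

End Partner.

Section AllIn.
Variables (V : finType) (D : rel V) (y e : V).
Hypotheses (D_irr : irreflexive D) (D_strong : strong D) (D_noneven : noneven D).
Hypotheses (D_near : forall x, x != e -> near D x) (D_out2 : out2 D).
Hypothesis ye : D y e.

(** The last vertex [z] sends arcs to [y] and to its dominators only, and by [out2] it
    has a dominator [b]. Its partners dominate it, so it has at most one and is
    adjacent to all vertices. This forces every out-neighbour [q] of [y] to dominate
    [z], since an arc [q -> z] would by-pass [b]. But two out-neighbours of [y] cannot
    both dominate [z]. *)
Lemma not_all_in : ~ forall t, t != y -> D t y.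
Proof.
move=> all_in; have /nonevenP[w0 /(normalized_weighting y D_irr)] := D_noneven.
case=> w [w_odd w_out w_in].
have e_y : e != y by rewrite eq_sym (irreflexive_neq D_irr ye).
have [||z zS zlast] := last_in D_irr w_odd w_in (S := [set~ y]) (x := e).
- by rewrite !inE.
- by move=> t; rewrite !inE; apply: all_in.
have zy : z != y by rewrite !inE in zS.
have {}zlast t : t != y -> D z t -> dominates D y t z.
  by move=> ty; apply: zlast; rewrite !inE.
have [b zb /zlast/(_ zb) bz] := D_out2 z y.
have nyz := dominating_not_root bz.
have ze : z != e by apply: contraNneq nyz => ->.
have puniq c c' : c \in partners D z -> c' \in partners D z -> c = c'.
  have P d : d \in partners D z -> dominates D y d z /\ D d z.
    rewrite inE => /andP[zd dz]; split=> //; apply: zlast => //.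
    by apply: contraNneq nyz => <-.
  by move=> /P[d1 d2] /P[d3 d4]; exact: (dominating_pred_uniq d1 d3).
have {puniq} adj q : D y q -> dominates D y q z.
  move=> yq; have qz : q != z by apply: contraNneq nyz => <-.
  have qy : q != y by rewrite eq_sym (irreflexive_neq D_irr yq).
  have [zq|nzq] := boolP (D z q); first exact: zlast.
  have dq := near_adjacent (D_near ze) qz puniq nzq.
  apply/negPn/negP => nq.
  have qb : q != b by apply: contraNneq nq => ->.
  by have := dominates_pred bz dq qb; rewrite dominates_root.
have [q yq qe] := D_out2 y e.
by have := root_not_dominating z D_strong yq ye qe; rewrite !adj.
Qed.

End AllIn.

Section BothParities.
Variables (V : finType) (D : rel V) (y e m : V) (w : V -> V -> bool).
Hypotheses (D_irr : irreflexive D) (D_strong : strong D).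
Hypothesis (w_odd : odd_weighting D w).
Hypotheses (D_near : forall x, x != e -> near D x) (D_out2 : out2 D).
Hypothesis ye : D y e.

(** If all simple paths from [y] to [m] had the same parity, then the arc [m -> y]
    could be added with a weight that makes the new cycles odd, and the resulting
    digraph would contradict [not_all_in]. *)
Lemma both_parities b : m != y -> (forall t, t != y -> t != m -> D t y) ->
  ~ forall s, path D y s -> uniq (y :: s) -> last y s = m -> parity w y s = b.
Proof.
move=> my all_in par.
pose D' u v := D u v || (u == m) && (v == y).
have sub : subrel D D' by move=> u v uv; rewrite /D' uv.
pose w' u v := if (u == m) && (v == y) then ~~ b else w u v.
have same a s : y \notin s -> (path D' a s = path D a s) /\ (parity w' a s = parity w a s).
  elim: s a => //= c s IH a; rewrite inE negb_or eq_sym => /andP[cy /IH IHs].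
  have [-> ->] := IHs c.
  by rewrite /D' /w' (negbTE cy) andbF orbF.
apply: (@not_all_in V D' y e).
- move=> u; rewrite /D' D_irr /=; apply/negP => /andP[/eqP-> /eqP mm].
  by rewrite mm eqxx in my.
- exact: strong_subrel D_strong.
- apply/nonevenP; exists w'; apply: (@odd_weighting_rooted _ _ y).
    move=> s Us; have ys : y \notin s by case/andP: Us.
    rewrite rcons_path parity_rcons; have [-> ->] := same y s ys.
    rewrite /D' /w'; case: (last y s =P m) => [lm|_] /= /andP[Ps ly].
      by rewrite eqxx (par s) // addbN addbb.
    rewrite orbF in ly.
    by have := w_odd Us; rewrite rcons_path parity_rcons Ps ly; apply.
  move=> a s yas Us; have ys : y \notin rcons s a.
    by move: yas; rewrite !inE mem_rcons inE.
  by have [-> ->] := same a _ ys; exact: w_odd.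
- by move=> x /D_near; apply: near_subrel.
- by move=> x a; have [c /sub xc ca] := D_out2 x a; exists c.
- exact: sub.
move=> t ty; rewrite /D'; case: (t =P m) => [_|/eqP tm]; first by rewrite eqxx orbT.
by rewrite all_in.
Qed.

End BothParities.

(** * A vertex with two out-neighbours *)

(** The two exceptions by their out-neighbourhoods, the vertices being listed in the
    cyclic order of [W4] and of [C4]. *)
Definition W4_like (V : finType) (D : rel V) := exists y m p z : V,
  [/\ uniq [:: y; m; p; z], forall u, u \in [:: y; m; p; z]
    & [/\ D y =i [:: m; p], D m =i [:: p; z], D p =i [:: z; y] & D z =i [:: y; m]]].

Definition C4_like (V : finType) (D : rel V) := exists y z m v : V,
  [/\ uniq [:: y; z; m; v], forall u, u \in [:: y; z; m; v]
    & [/\ D y =i [:: z; v], D z =i [:: y; m], D m =i [:: z; v] & D v =i [:: y; m]]].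

(* Decides the distinctness conditions of explicit short walks. *)
Ltac neqs :=
  rewrite /= ?inE ?negb_or /=;
  repeat match goal with |- is_true (andb _ _) => apply/andP; split end;
  solve [by [] | by rewrite eq_sym].

Section Core.
Variables (V : finType) (D : rel V) (y e : V) (w : V -> V -> bool).
Hypotheses (D_irr : irreflexive D) (D_strong : strong D).
Hypothesis (w_odd : odd_weighting D w).
Hypotheses (w_out : forall q, D y q -> w y q = false).
Hypotheses (w_in : forall t, D t y -> w t y).
Hypotheses (D_near : forall x, x != e -> near D x) (D_out2 : out2 D).
Hypothesis ye : D y e.

Local Notation dom := (dominates D y).
Let neq u v : D u v -> u != v := irreflexive_neq D_irr (u := u) (v := v).
Let neq' u v : D u v -> v != u. Proof. by move=> /neq; rewrite eq_sym. Qed.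

Lemma two_cycle u v : D u v -> D v u -> w u v (+) w v u.
Proof.
move=> uv vu; have /= := @w_odd u [:: v]; rewrite inE uv vu neq //.
by move=> /(_ isT isT); rewrite addbF.
Qed.

Lemma dominated_partners x :
  (forall c, D x c -> D c x -> dom c x) ->
  forall c c', c \in partners D x -> c' \in partners D x -> c = c'.
Proof.
move=> H c c'; rewrite !inE => /andP[xc cx] /andP[xc' c'x].
exact: (dominating_pred_uniq (H c xc cx) (H c' xc' c'x)).
Qed.

(** The form in which [near] is used for last vertices. *)
Lemma dominated_adjacent x u : x != e -> u != x ->
  (forall c, D x c -> D c x -> dom c x) -> ~~ D x u -> D u x.
Proof.
by move=> xe ux /dominated_partners; apply: near_adjacent => //; apply: D_near.
Qed.

(** Suppose that there are other vertices. They are reached through [p] only, so that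
    [p] dominates them, and the last of them, [x], sends an arc to [m]. An even path
    [p .. x] then closes to the cycles [p .. x m p] and [y p .. x m z y]; since
    [m -> p] and [m -> z] have weight 0, one of them is even. *)
Lemma no_others p m z :
  (forall u, D y u -> u \in [:: p; m]) -> D y p -> D y m ->
  D m p -> D m z -> (forall u, D m u -> u \in [:: p; z]) -> w m p = false ->
  (forall u, D z u -> u \in [:: y; m; p]) -> D z y -> z != p ->
  (forall t, t \notin [:: y; p; m] -> D t y) ->
  forall x, x \in [:: y; m; p; z].
Proof.
move=> outy yp ym mp mz outm wmp outz zy zp inT x0; apply: contraT => x0S.
pose S := [set x | x \notin [:: y; m; p; z]].
have SP x : x \in S -> [/\ x != y, x != m, x != p & x != z].
  by rewrite !inE !negb_or => /and4P[-> -> -> ->].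
have Sy x : x \in S -> D x y.
  by case/SP=> a b c d; apply: inT; rewrite !inE !negb_or a b c.
have [||x xS xlast] := last_in D_irr w_odd w_in (S := S) (x := x0) => //.
  by rewrite inE.
have [xy xm xp xz] := SP x xS.
have Sdom t : t \in S -> dom p t.
  case/SP=> a b c d; apply: (@dominates_entry _ _ _ [set y; m; z]) => //.
  - by rewrite !inE eqxx.
  - by rewrite !inE !negb_or eq_sym neq //= neq' // eq_sym zp.
  - move=> b' u; rewrite !inE -orbA => /or3P[]/eqP->.
    + by move/outy; rewrite !inE => /orP[]/eqP->; rewrite ?eqxx ?orbT.
    + by move/outm; rewrite !inE => /orP[]/eqP->; rewrite ?eqxx ?orbT.
    + by move/outz; rewrite !inE => /or3P[]/eqP->; rewrite ?eqxx ?orbT.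
  - by rewrite !inE (negbTE a) (negbTE b) (negbTE d).
have nmx : ~~ D m x.
  by apply/negP => /outm; rewrite !inE (negbTE xp) (negbTE xz).
have xe : x != e.
  by have := outy e ye; rewrite !inE => /orP[]/eqP->.
have xm' : D x m.
  apply: (contraNT _ (nmx)); apply: dominated_adjacent => //; first by rewrite eq_sym.
  move=> c xc cx; have [->|cp] := eqVneq c p; first exact: Sdom.
  apply: xlast => //; rewrite !inE !negb_or cp /=; apply/and3P; split.
  - by apply: contraTneq cx => ->; apply/negP => /outy; rewrite !inE (negbTE xp) (negbTE xm).
  - by apply: contraTneq cx => ->.
  - by apply: contraTneq cx => ->; apply/negP => /outz; rewrite !inE (negbTE xy) (negbTE xp) (negbTE xm).
have [s [Ps Us sx ds s0]] :=
  dominates_path_even D_irr D_strong w_odd w_out w_in yp (Sdom x xS) (Sy x xS).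
have ys : y \notin s by apply/negP => /(allP ds); rewrite dominates_y.
have ms : m \notin s by apply/negP => /(allP ds); rewrite dominates_root.
have zs : z \notin s.
  apply/negP => /(allP ds) pz; have := dominates_pred pz mz (neq mp).
  by rewrite dominates_root.
have my : m != y := neq' ym.
have zm : z != m := neq' mz.
have U1 : uniq (p :: rcons s m).
  by rewrite -rcons_cons rcons_uniq inE negb_or (neq mp) ms.
have := w_odd U1; rewrite rcons_path last_rcons rcons_path Ps sx xm' mp.
rewrite !parity_rcons last_rcons sx s0 wmp /= addbF => /(_ isT) wxm.
have U2 : uniq (y :: rcons (rcons (p :: s) m) z).
  rewrite -!rcons_cons !rcons_uniq !mem_rcons !inE !negb_or.
  rewrite zm (neq zy) zp zs my (neq mp) ms cons_uniq !inE !negb_or (neq yp) ys.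
  exact: Us.
have := path_even w_odd w_in _ U2; rewrite !rcons_path !last_rcons /= yp Ps.
rewrite sx xm' mz zy => /(_ isT isT).
rewrite w_out // !parity_rcons last_rcons sx s0 wxm /=.
by rewrite (root_arc_even D_irr w_odd w_out w_in ym mz zy).
Qed.


(** One two-cycle, with [p], at the root; here [m] is the only vertex without an arc
    to [y]. Let [z] be the last of the others. If [z] has a dominator, then [p]
    dominates [z] and the only out-neighbour of [m] is [p]. Otherwise [y] and [m] are
    the out-neighbours of [z]. If moreover [z] is not [p], then [no_detour] leaves
    only [p] and [z] as out-neighbours of [m], and [no_others] shows that there are
    four vertices. If [z] is [p], then [m] dominates all other vertices, and with an
    even path from [m] to the last of them, [x], one of the cycles [y p m .. x y] and
    [m .. x p m] is even. *)
Lemma one_partner p m : (forall u, D y u -> u \in [:: p; m]) -> D y p -> D y m ->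
  ~~ D m y -> (forall t, t \notin [:: y; m] -> D t y) -> p != m -> W4_like D.
Proof.
move=> outy yp ym nmy inT pm.
have py : p != y := neq' yp.
have my : m != y := neq' ym.
have {}inT t : t != y -> t != m -> D t y.
  by move=> a b; apply: inT; rewrite !inE negb_or a b.
have py' : D p y by apply: inT.
pose S := [set t | (t != y) && (t != m)].
have [||z zS zlast] := last_in D_irr w_odd w_in (S := S) (x := p).
- by rewrite inE py.
- by move=> t; rewrite inE => /andP[]; apply: inT.
have {zS} [zy zm] : z != y /\ z != m by move: zS; rewrite inE => /andP[].
have {}zlast t : t != y -> t != m -> D z t -> dom t z.
  by move=> a b; apply: zlast; rewrite inE a.
have zy' : D z y by apply: inT.
have [/existsP[d dz]|] := boolP [exists d, dom d z].
  have nyz := dominating_not_root dz.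
  have zp : z != p by apply: contraNneq nyz => ->.
  have ze : z != e by apply: contraNneq nyz => ->.
  have domm : D m z -> dom m z.
    move=> mz; have [<-//|md] := eqVneq d m.
    by have := dominates_pred dz mz _; rewrite dominates_root // eq_sym => /(_ md).
  have parts c : D z c -> D c z -> dom c z.
    move=> zc cz; have [cm|cm] := eqVneq c m; first by rewrite cm domm // -cm.
    by apply: zlast => //; apply: contraNneq nyz => <-.
  have pz : dom p z.
    have [zp'|nzp] := boolP (D z p); first exact: zlast.
    have pz : D p z by apply: dominated_adjacent => //; rewrite eq_sym.
    have [<-//|dp] := eqVneq d p.
    by have := dominates_pred dz pz _; rewrite dominates_root // eq_sym => /(_ dp).
  have nmz : ~~ D m z.
    apply/negP => mz; have := dominates_pred pz mz _.
    by rewrite dominates_root // eq_sym => /(_ pm).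
  have [r mr rp] := D_out2 m p.
  have rz : r != z by apply: contraNneq nmz => <-.
  have npr : ~~ dom p r.
    apply/negP => pr; have := dominates_pred pr mr _.
    by rewrite dominates_root // eq_sym => /(_ pm).
  case/negP: npr; have [zr|nzr] := boolP (D z r).
    have rz' : dom r z.
      by apply: zlast => //; [apply: contraNneq nmy => <-|exact: neq'].
    by have := dominates_chain D_strong rz' pz rp; rewrite dominates_root.
  by apply: (dominates_pred pz) => //; apply: dominated_adjacent.
move=> /existsPn nodom.
have outz t : D z t -> t \in [:: y; m].
  move=> zt; rewrite !inE; apply/norP => -[ty tm].
  by have := nodom t; rewrite zlast.
have zm' : D z m.
  by have [b zb] := D_out2 z y; move/outz: (zb); rewrite !inE => /orP[]/eqP bE; rewrite bE ?eqxx // -bE.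
have [zp|zp] := eqVneq z p; last first.
  have nyz : ~~ D y z by apply/negP => /outy; rewrite !inE (negbTE zp) (negbTE zm).
  have ze : z != e by apply: contraNneq nyz => ->.
  have adj u : u != z -> u != y -> u != m -> D u z.
    move=> uz uy um; apply: (near_adjacent (D_near ze)) => //.
      move=> c c'; rewrite !inE => /andP[/outz + cz] /andP[/outz + c'z].
      rewrite !inE => /orP[]/eqP cE /orP[]/eqP c'E; rewrite cE c'E //; first by rewrite cE (negbTE nyz) in cz.
      by rewrite c'E (negbTE nyz) in c'z.
    by apply/negP => /outz; rewrite !inE (negbTE uy) (negbTE um).
  have pz : D p z by apply: adj; rewrite // eq_sym.
  have outm c : D m c -> c \in [:: p; z].
    move=> mc; rewrite !inE; apply/norP => -[cp cz].
    have cy : c != y by apply: contraNneq nmy => <-.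
    have cm : c != m := neq' mc.
    have cz' : D c z := adj c cz cy cm.
    have cy' := inT c cy cm.
    have wcz : w c z = false.
      apply: (arc_even D_irr w_odd w_in) => //.
      by apply: reach_step (reach_root ym _) mc cz; rewrite eq_sym.
    apply: (no_detour D_irr w_odd w_in zm' mc cz' cy' zy' wcz (s := [:: p; z])) => //=.
    - by rewrite yp pz.
    - neqs.
    - neqs.
    - neqs.
  have mz : D m z.
    by have [b mb] := D_out2 m p; move/outm: (mb); rewrite !inE => /orP[]/eqP bE; rewrite bE ?eqxx // -bE.
  have mp : D m p.
    by have [b mb] := D_out2 m z; move/outm: (mb); rewrite !inE => /orP[]/eqP bE; rewrite bE ?eqxx // -bE.
  have wmp : w m p = false by apply: (root_arc_even D_irr w_odd w_out w_in ym).
  have all4 : forall x, x \in [:: y; m; p; z].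
    apply: no_others => // [u /outz|t].
      by rewrite !inE => /orP[]->; rewrite ?orbT.
    by rewrite !inE !negb_or => /and3P[a _ b]; apply: inT.
  have npm : ~~ D p m.
    apply/negP => pm'; have := two_cycle mp pm'; rewrite wmp /= => wpm.
    have U : uniq [:: y; p; m; z].
      neqs.
    have := path_even w_odd w_in _ U; rewrite /= yp pm' mz zy' w_out // wpm.
    by rewrite (root_arc_even D_irr w_odd w_out w_in ym mz zy') => /(_ isT isT).
  exists y, m, p, z; split=> //.
    neqs.
  split=> u; rewrite !inE; apply/idP/orP.
  - by move/outy; rewrite !inE orbC => /orP.
  - by case=> /eqP->.
  - by move/outm; rewrite !inE => /orP.
  - by case=> /eqP->.
  - move=> pu; have := all4 u; rewrite !inE => /or4P[]/eqP uE; subst u.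
    + by right.
    + by case/negP: npm.
    + by have := D_irr p; rewrite [D p p]pu.
    + by left.
  - by case=> /eqP->.
  - by move/outz; rewrite !inE => /orP.
  - by case=> /eqP->.
subst z; have [r mr rp] := D_out2 m p.
pose S2 := [set t | t \notin [:: y; p; m]].
have rS : r \in S2.
  by rewrite !inE !negb_or rp (neq' mr) !andbT; apply: contraNneq nmy => <-.
have [|x xS xlast] := last_in D_irr w_odd w_in (S := S2) rS.
  by move=> t; rewrite !inE !negb_or => /and3P[a _ b]; apply: inT.
have Sdom t : t \in S2 -> dom m t.
  rewrite !inE !negb_or => /and3P[ty tp tm].
  apply: (@dominates_entry _ _ _ [set y; p]) => //.
  - by rewrite !inE eqxx.
  - by rewrite !inE negb_or my eq_sym.
  - move=> b u; rewrite !inE => /orP[]/eqP->.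
    + by move/outy; rewrite !inE => /orP[]/eqP->; rewrite ?eqxx ?orbT.
    + by move/outz; rewrite !inE => /orP[]/eqP->; rewrite ?eqxx ?orbT.
  - by rewrite !inE negb_or ty tp.
have [xy xp xm] : [/\ x != y, x != p & x != m].
  by move: xS; rewrite !inE !negb_or => /and3P[].
have xe : x != e.
  by have := outy e ye; rewrite !inE => /orP[]/eqP->.
have nyx : ~~ D y x by apply/negP => /outy; rewrite !inE (negbTE xp) (negbTE xm).
have npx : ~~ D p x by apply/negP => /outz; rewrite !inE (negbTE xy) (negbTE xm).
have xp' : D x p.
  apply: (contraNT _ (npx)); apply: dominated_adjacent => //; first by rewrite eq_sym.
  move=> c xc cx; have [->|cm] := eqVneq c m; first exact: Sdom.
  apply: xlast => //; rewrite !inE !negb_or cm andbT.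
  by apply/andP; split; [apply: contraNneq nyx => <-|apply: contraNneq npx => <-].
have xy' := inT x xy xm.
have [s [Ps Us sx ds s0]] :=
  dominates_path_even D_irr D_strong w_odd w_out w_in ym (Sdom x xS) xy'.
have ys : y \notin s by apply/negP => /(allP ds); rewrite dominates_y.
have ps : p \notin s by apply/negP => /(allP ds); rewrite dominates_root.
have wxp : w x p = false.
  apply: (arc_even D_irr w_odd w_in) => //.
  have -> : x = last y (m :: s) by [].
  by apply: reach_walk; rewrite /= ?ym // inE negb_or pm.
have U1 : uniq (m :: rcons s p).
  by rewrite -rcons_cons rcons_uniq inE negb_or pm ps.
have := w_odd U1; rewrite rcons_path last_rcons rcons_path Ps sx xp' zm'.
rewrite !parity_rcons last_rcons sx s0 wxp /= => /(_ isT) wpm.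
have U2 : uniq (y :: p :: m :: s).
  by have /andP[ms us] := Us; neqs.
have := path_even w_odd w_in _ U2; rewrite /= yp zm' Ps sx xy' w_out // wpm s0.
by move=> /(_ isT isT).
Qed.

(** No two-cycle at the root. The two out-neighbours [p] and [v] play symmetric
    roles, and all other vertices are in-neighbours of the root. *)
Definition no_partner p v :=
  [/\ D y p, D y v & p != v] /\
  [/\ forall u, D y u -> u \in [:: p; v], ~~ D p y, ~~ D v y
    & forall t, t \notin [:: y; p; v] -> D t y].

Lemma no_partnerC p v : no_partner p v -> no_partner v p.
Proof.
case=> -[a b c] [d f g h]; split; split=> //; first by rewrite eq_sym.
  by move=> u /d; rewrite !inE orbC.
by move=> t; rewrite !inE [(t == v) || _]orbC; have := h t; rewrite !inE.
Qed.

Lemma out_in_rest p v r : no_partner p v -> D v r -> r != p ->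
  [/\ r != y, r != v & D r y].
Proof.
move=> [[yp yv pv] [outy npy nvy inT]] vr rp.
have ry : r != y by apply: contraNneq nvy => <-.
have rv := neq' vr; split=> //; apply: inT.
by rewrite !inE !negb_or ry rp.
Qed.

(** Read off the cycle [y p v t y], for an out-neighbour [t] of [v]. *)
Lemma no_partner_arc p v : no_partner p v -> D p v -> w p v = false.
Proof.
move=> H; have [[yp yv pv] [outy npy nvy inT]] := H => pv'.
have [t vt tp] := D_out2 v p; have [ty tv ty'] := out_in_rest H vt tp.
have [py vy] : p != y /\ v != y by split; apply: neq'.
have U : uniq [:: y; p; v; t] by neqs.
have := path_even w_odd w_in _ U; rewrite /= yp pv' vt ty' => /(_ isT isT).
by rewrite w_out // (root_arc_even D_irr w_odd w_out w_in yv vt) //= !addbF.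
Qed.

Lemma no_partner_one_arc p v : no_partner p v -> D p v -> ~~ D v p.
Proof.
move=> H pv; apply/negP => vp; have := two_cycle pv vp.
by rewrite !no_partner_arc //; exact: no_partnerC.
Qed.

Lemma root_pred_dominates d z q : dom d z -> D y q -> D q z -> dom q z.
Proof.
move=> dz yq qz; have [<-//|dq] := eqVneq d q.
by have := dominates_pred dz qz _; rewrite dominates_root // eq_sym => /(_ dq).
Qed.

(** If the last vertex [z] is dominated, then so it is by all out-neighbours of [v]
    other than [p], and no two of them can dominate it. *)
Lemma no_partner_dominator p v d z : no_partner p v ->
  (forall t, D t y -> D z t -> dom t z) -> dom d z ->
  (forall u, u != z -> ~~ D z u -> D u z) ->
  ~~ dom v z -> D v p /\ ~~ dom p z.
Proof.
move=> H zlast dz adj nvz; have [[yp yv pv] [outy npy nvy inT]] := H.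
have domr r : D v r -> r != p -> dom r z.
  move=> vr rp; have [ry rv ry'] := out_in_rest H vr rp.
  have rz : r != z.
    by apply: contraNneq nvz => rz; rewrite rz in vr; exact: root_pred_dominates dz _ _.
  have [zr|nzr] := boolP (D z r); first exact: zlast.
  have [<-//|dr] := eqVneq d r.
  have rd : r != d by rewrite eq_sym.
  have [dv|dv] := eqVneq d v; first by rewrite -dv dz in nvz.
  have := dominates_pred (dominates_pred dz (adj r rz nzr) rd) vr.
  by rewrite dominates_root // eq_sym => /(_ dv).
have notdom a b : D v b -> a != v -> ~~ dom a b.
  move=> vb av; apply/negP => /dominates_pred/(_ vb).
  by rewrite dominates_root // eq_sym => /(_ av).
have [r vr rp] := D_out2 v p; have rz := domr r vr rp.
split; last first.
  apply/negP => pz; have := dominates_chain D_strong rz pz rp.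
  by rewrite dominates_root // (negbTE (notdom p r _ _)).
have [r' vr' rr'] := D_out2 v r; have [<-//|r'p] := eqVneq r' p.
have := dominates_chain D_strong rz (domr r' vr' r'p).
rewrite eq_sym rr' => /(_ isT).
by rewrite !(negbTE (notdom _ _ _ _)) ?neq'.
Qed.

(** The arc [z -> v] has weight 1, because of the cycle [v z v] or [v c z v]; hence
    [y p t z v c y] is even, where [t] is skipped if it is [z]. *)
Lemma no_partner_short p v z t c : no_partner p v -> D z y -> D z v ->
  z \notin [:: y; p; v] -> (forall r, D r y -> r != z -> r != y -> D r z) ->
  D p t -> t != v -> D v c -> c != p -> c != z -> c != t -> False.
Proof.
move=> H zy' zv zn adj pt tv vc cp cz ct; have [[yp yv pv] [outy npy nvy inT]] := H.
have [ty tp ty'] := out_in_rest (no_partnerC H) pt tv.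
have [cy cv cy'] := out_in_rest H vc cp.
have [zy zp zv'] : [/\ z != y, z != p & z != v] by move: zn; rewrite !inE !negb_or => /and3P[].
have [py vy] : p != y /\ v != y by split; apply: neq'.
have wvr := root_arc_even D_irr w_odd w_out w_in yv.
have wpt := root_arc_even D_irr w_odd w_out w_in yp.
have wzv : w z v.
  have [vz|nvz] := boolP (D v z).
    by have := two_cycle zv vz; rewrite wvr // addbF.
  have cz' := adj c cy' cz cy.
  have U : uniq [:: v; c; z] by neqs.
  have := w_odd U; rewrite /= vc cz' zv => /(_ isT); rewrite wvr //.
  rewrite (arc_even D_irr w_odd w_in cz' cy' zy') ?addbF //.
  by apply: reach_step (reach_root yv _) vc cz; rewrite eq_sym.
have [tz|tz] := eqVneq t z.
  subst t; have U : uniq [:: y; p; z; v; c] by neqs.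
  have := path_even w_odd w_in _ U; rewrite /= yp pt zv vc cy' => /(_ isT isT).
  by rewrite w_out // wpt // wvr // wzv.
have tz' := adj t ty' tz ty.
have U : uniq [:: y; p; t; z; v; c] by neqs.
have := path_even w_odd w_in _ U; rewrite /= yp pt tz' zv vc cy' => /(_ isT isT).
rewrite w_out // wpt // wvr // wzv (arc_even D_irr w_odd w_in tz' ty' zy') //.
by apply: reach_step (reach_root yp _) pt tz; rewrite eq_sym.
Qed.

(** [no_partner_short] says that [v] has no other out-neighbours than [p], [z] and any
    given out-neighbour of [p]. If [v -> p], it follows that [v] has the
    out-neighbours [p] and [z] only, as in [no_others]. Otherwise [v] has two
    out-neighbours [z] and [c], and [p] has the out-neighbours [v] and [c]; then
    [z -> p], and the same statement with [p] and [v] exchanged is violated. *)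
Lemma no_partner_sink_arc p v z : no_partner p v -> D z y -> D z v ->
  z \notin [:: y; p; v] -> (forall u, D z u -> u \in [:: y; v; p]) ->
  (forall u, u != z -> ~~ D z u -> D u z) -> False.
Proof.
move=> H zy' zv zn outz adj; have H' := no_partnerC H.
have [[yp yv pv] [outy npy nvy inT]] := H.
have [zy zp zv'] : [/\ z != y, z != p & z != v] by move: zn; rewrite !inE !negb_or => /and3P[].
have adj' r : D r y -> r != z -> r != y -> D r z.
  move=> ry' rz ry; apply: adj => //; apply/negP => /outz; rewrite !inE => /or3P[]/eqP rE.
  - by rewrite rE eqxx in ry.
  - by rewrite rE (negbTE nvy) in ry'.
  - by rewrite rE (negbTE npy) in ry'.
have short t c := @no_partner_short p v z t c H zy' zv zn adj'.
have [vp|nvp] := boolP (D v p).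
  have npv := no_partner_one_arc H' vp.
  have npv' t : D p t -> t != v by move=> pt; apply: contraNneq npv => <-.
  have [t1 pt1 t1z] := D_out2 p z; have [t2 pt2 t21] := D_out2 p t1.
  have outv c : D v c -> c \in [:: p; z].
    move=> vc; rewrite !inE; apply/norP => -[cp cz].
    have [ct1|ct1] := eqVneq c t1; last exact: (short t1 c pt1 (npv' _ pt1)).
    by apply: (short t2 c pt2 (npv' _ pt2)) => //; rewrite ct1 eq_sym.
  have vz : D v z.
    by have [b vb] := D_out2 v p; move/outv: (vb); rewrite !inE => /orP[]/eqP bE; rewrite bE ?eqxx // -bE.
  have [t1y t1p t1y'] := out_in_rest H' pt1 (npv' _ pt1).
  have := no_others outy yp yv vp vz outv (no_partner_arc H' vp) outz zy' zp inT t1.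
  by rewrite !inE (negbTE t1y) (negbTE t1p) (negbTE t1z) (negbTE (npv' _ pt1)).
have nvp' c : D v c -> c != p by move=> vc; apply: contraNneq nvp => <-.
have [c vc cz] := D_out2 v z.
have outp t : D p t -> t != v -> t = c.
  move=> pt tv; apply/eqP; apply: contraT => tc; exfalso.
  by apply: (short t c) => //; [exact: nvp'|rewrite eq_sym].
have [t pt tv] := D_out2 p v; have tc := outp t pt tv; subst t.
have [r vr rc] := D_out2 v c.
have rz : r = z.
  by apply/eqP; apply: contraT => rz; exfalso; apply: (short c r) => //; exact: nvp'.
subst r; have npz : ~~ D p z.
  by apply/negP => pz; move: rc; rewrite (outp z) ?eqxx.
have zp' : D z p by apply: contraNT npz; apply: adj; rewrite eq_sym.
apply: (@no_partner_short v p z z c H') => //.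
by move: zn; rewrite !inE [(z == v) || _]orbC.
Qed.

Lemma no_partner_false p v : ~ no_partner p v.
Proof.
move=> H; have H' := no_partnerC H; have [[yp yv pv] [outy npy nvy inT]] := H.
have [t pt tv] := D_out2 p v; have [ty tp ty'] := out_in_rest H' pt tv.
pose S := [set t | t \notin [:: y; p; v]].
have tS : t \in S by rewrite inE; neqs.
have [|z zS zlast] := last_in D_irr w_odd w_in (S := S) tS.
  by move=> u; rewrite inE; apply: inT.
have {zS}zn : z \notin [:: y; p; v] by rewrite inE in zS.
have zy' := inT z zn.
have {}zlast u : D u y -> D z u -> dom u z.
  move=> uy zu; apply: zlast => //; rewrite !inE !negb_or (neq uy) /=.
  by apply/andP; split; apply: contraTneq uy => ->.
have [zy zp zv] : [/\ z != y, z != p & z != v] by move: zn; rewrite !inE !negb_or => /and3P[].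
have nyz : ~~ D y z by apply/negP => /outy; rewrite !inE (negbTE zp) (negbTE zv).
have ze : z != e by apply: contraNneq nyz => ->.
have [/existsP[d dz]|] := boolP [exists d, dom d z].
  have adj u : u != z -> ~~ D z u -> D u z.
    move=> uz; apply: dominated_adjacent => // c zc cz.
    have [cQ|] := boolP (c \in [:: p; v]).
      by apply: (root_pred_dominates dz) => //; move: cQ; rewrite !inE => /orP[]/eqP->.
    rewrite !inE negb_or => /andP[cp cv]; apply: zlast => //; apply: inT.
    by rewrite !inE !negb_or cp cv !andbT; apply: contraNneq nyz => <-.
  have F p' v' : no_partner p' v' -> ~~ dom v' z -> False.
    move=> H0 nvz; have [vp npz] := no_partner_dominator H0 zlast dz adj nvz.
    have [pv' _] := no_partner_dominator (no_partnerC H0) zlast dz adj npz.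
    by have := no_partner_one_arc H0 pv'; rewrite vp.
  by have /orP[] := root_not_dominating z D_strong yp yv pv; [exact: F H'|exact: F H].
move/existsPn=> nodom.
have outz u : D z u -> u \in [:: y; v; p].
  move=> zu; apply: contraT => nu; have := nodom u; rewrite zlast //.
  by apply: inT; move: nu; rewrite !inE [(u == p) || _]orbC.
have outz' u : D z u -> u \in [:: y; p; v].
  by move/outz; rewrite !inE [(u == p) || _]orbC.
have [b zb bny] := D_out2 z y.
have [nzQ|] := boolP [&& D z p, D p z, D z v & D v z].
  have F p' v' : no_partner p' v' -> z \notin [:: y; p'; v'] -> 
      [&& D z p', D p' z, D z v' & D v' z] -> D v' p'.
    move=> H0 zn0 /and4P[zp' pz zv' vz]; have [[yp0 yv0 pv0] [_ _ _ _]] := H0.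
    have [x vx xz] := D_out2 v' z; have [<-//|xp] := eqVneq x p'; exfalso.
    have [xy xv xy'] := out_in_rest H0 vx xp.
    have [py vy] : p' != y /\ v' != y by split; apply: neq'.
    have := two_cycle zv' vz.
    rewrite (root_arc_even D_irr w_odd w_out w_in yv0 vz) // addbF => wzv.
    have [? ?] : z != p' /\ z != v' by split; apply: neq.
    have U : uniq [:: y; p'; z; v'; x] by neqs.
    have := path_even w_odd w_in _ U; rewrite /= yp0 pz zv' vx xy' => /(_ isT isT).
    rewrite w_out // (root_arc_even D_irr w_odd w_out w_in yp0 pz) //.
    by rewrite (root_arc_even D_irr w_odd w_out w_in yv0 vx) // wzv.
  have vp := F p v H zn nzQ.
  have := no_partner_one_arc H' vp; rewrite (F v p) //.
    by move: zn; rewrite !inE [(z == v) || _]orbC.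
  by case/and4P: nzQ => -> -> -> ->.
move=> nz2; have adj u : u != z -> ~~ D z u -> D u z.
  move=> uz; apply: near_adjacent => //; first exact: D_near.
  move=> c c'; rewrite !inE => /andP[zc cz] /andP[zc' cz'].
  have P x : D z x -> D x z -> (x == v) || (x == p).
    move=> zx xz; move/outz: zx; rewrite !inE => /or3P[]/eqP xE; subst x.
    - by rewrite (negbTE nyz) in xz.
    - by rewrite eqxx.
    - by rewrite eqxx orbT.
  move: (P c zc cz) (P c' zc' cz') nz2.
  by case/orP=> /eqP cE /orP[]/eqP c'E; subst c c' => //; rewrite zc cz zc' cz'.
move/outz: (zb); rewrite !inE (negbTE bny) /= => /orP[]/eqP bE; subst b.
  exact: (no_partner_sink_arc H zy' zb zn outz adj).
apply: (no_partner_sink_arc H' zy' zb _ outz' adj).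
by move: zn; rewrite !inE [(z == v) || _]orbC.
Qed.

(** A path reaches a dominator before the vertices that it dominates. *)
Lemma path_to_dominator d c s : path D y s -> uniq (y :: s) -> last y s = d ->
  dom d c -> c \notin s.
Proof.
move=> Ps Us sd dc; apply/negP => cs; have cd := dominates_neq dc.
case/splitPr: cs Ps Us sd => s1 s2; rewrite cat_path last_cat => /=.
move=> /and3P[P1 P2 P3] /andP[ys U] ld.
have ds : d \notin rcons s1 c.
  rewrite mem_rcons inE negb_or cd /=; apply/negP => d1.
  move: U; rewrite cat_uniq => /and3P[_ /hasP[]]; exists d => //.
  by rewrite -ld mem_last.
have := @reach_walk _ D y d (rcons s1 c); rewrite rcons_path P1 P2 last_rcons.
by move=> /(_ isT ds) rc; case/and3P: dc => _ _ /negP.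
Qed.

Section TwoPartners.
Variable m : V.
Hypotheses (my : m != y) (nmy : ~~ D m y) (nym : ~~ D y m).
Hypothesis inT : forall t, t != y -> t != m -> D t y.

Let no_parity b : ~ forall s, path D y s -> uniq (y :: s) -> last y s = m ->
  parity w y s = b.
Proof. exact: (both_parities D_irr D_strong w_odd D_near D_out2 ye). Qed.

Let m_neq t : D t y -> t != m.
Proof. by move=> ty; apply: contraNneq nmy => <-. Qed.

Let me : m != e.
Proof. by apply: contraNneq nym => ->. Qed.

(** If [z] dominated [m], then every simple path from [y] to [m] would end with the
    arc [z -> m], because the other out-neighbours of [z] come earlier on it; this
    would fix its parity. *)
Lemma last_not_dominates z : D z y ->
  (forall t, t != y -> t != m -> D z t -> dom t z) -> ~~ dom z m.
Proof.
move=> zy zlast; apply/negP => zm; apply: (@no_parity (w z m)) => s Ps Us sm.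
have zs : z \in s.
  apply/negPn/negP => zs; case/and3P: zm => _ _ /negP[].
  by rewrite -sm; apply: reach_walk.
case/splitPr: zs Ps Us sm => s1 s2; rewrite cat_path last_cat /=.
move=> /and3P[P1 P2 P3] /andP[ys]; rewrite cat_uniq => /and3P[U1 dis U2] lm.
case: s2 => [|u s2] in ys P3 dis U2 lm *.
  by move: lm => /= zm'; move: (m_neq zy); rewrite zm' eqxx.
have [um|um] := eqVneq u m.
  case: s2 => [|u' s2] in ys P3 dis U2 lm *; last first.
    move: U2 => /= /and4P[_ us _ _]; move: us; rewrite um -lm /=.
    by rewrite mem_last.
  rewrite parity_cat /= um addbF addbA -parity_rcons.
  rewrite (path_even w_odd w_in) ?last_rcons ?rcons_path ?P1 //.
  rewrite cons_uniq mem_rcons inE negb_or rcons_uniq U1 andbT -andbA.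
  apply/and3P; split; first by rewrite eq_sym neq.
    by move: ys; rewrite mem_cat negb_or => /andP[].
  by apply: contra dis => z1; apply/hasP; exists z => //; rewrite inE eqxx.
have uy : u != y.
  by apply: contraNneq ys => <-; rewrite mem_cat !inE eqxx !orbT.
have /and3P[_ uz /negP[]] : dom u z by apply: zlast => //; case/andP: P3.
rewrite -(last_rcons y s1 z); apply: reach_walk; rewrite ?rcons_path ?P1 //.
rewrite mem_rcons inE negb_or uz /=; apply: contra dis => u1.
by apply/hasP; exists u => //; rewrite !inE eqxx orbT.
Qed.

(** The path to [c] through [m] can avoid [z]. *)
Lemma detour_arc_even z c : D z y -> ~~ dom z m -> D m c -> D c z -> w c z = false.
Proof.
move=> zy nzm mc cz; apply: (arc_even D_irr w_odd w_in) => //.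
  apply: inT; last exact: neq'.
  by apply: contraNneq nmy => <-.
apply: reach_step mc (neq cz).
by apply: not_dominates => //; [exact: neq|exact: m_neq].
Qed.

(** Suppose that [z] has a dominator, but is not dominated by [q]. Then [z] is not adjacent to [q],
    hence on exactly two two-cycles, with a dominator [d] and with [m], and [q'] is
    the other out-neighbour of the root, which dominates [z]. The out-neighbours of [q]
    are [y] and [q']. As every simple path to [m] can be made to avoid [q] without
    changing its parity, [both_parities] excludes the arc [m -> q]; now [m] is not
    adjacent to [y] and [q] and has a third partner [c]. It is dominated by [d], and
    [no_detour] applies to a path through [d]. *)
Lemma two_partners_dominator z q q' : D y q -> D y q' -> q != q' ->
  (forall u, D y u -> u \in [:: q; q']) -> z != y -> z != m ->
  (forall t, t != y -> t != m -> D z t -> dom t z) ->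
  forall d, dom d z -> dom q z.
Proof.
move=> yq yq' qq' outy zy zm zlast d0 d0z; apply: contraT => nqz.
have nyz := dominating_not_root d0z.
have ze : z != e by apply: contraNneq nyz => ->.
have zy' := inT zy zm.
have yneq t : D t z -> t != y by move=> tz; apply: contraNneq nyz => <-.
have qT t : D y t -> t != m by move=> yt; apply: contraNneq nym => <-.
have domp c : D z c -> D c z -> c != m -> dom c z.
  by move=> zc cz cm; apply: zlast => //; exact: yneq.
have domq t : D y t -> t \notin strangers D z -> dom t z.
  move=> yt; have tz : t != z by apply: contraNneq nyz => <-.
  rewrite !inE tz /= negb_and !negbK => /orP[zt|tz'].
    by apply: zlast => //; [exact: neq'|exact: qT].
  exact: root_pred_dominates d0z yt tz'.
have qstr : q \in strangers D z by apply: contraT => /(domq q yq); rewrite (negbTE nqz).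
have [d] := near_partner m (D_near ze) qstr; rewrite inE => /andP[zd dz] dm.
have ddz := domp d zd dz dm.
have only c : D z c -> D c z -> c != m -> c = d.
  by move=> zc cz cm; apply: (dominating_pred_uniq (domp c zc cz cm) ddz).
have [c] := near_partner d (D_near ze) qstr; rewrite inE => /andP[zc cz] cd.
have cm : c = m by apply/eqP; apply: contraNT cd => /(only c zc cz)->.
subst c; have onestr s : s \in strangers D z -> s = q.
  move=> sz; apply/eqP; apply: contraT => sq.
  have [c [+ cm' cd']] := near_partner2 m d (D_near ze) sz qstr sq.
  by rewrite inE => /andP[zc' cz']; rewrite (only c) ?eqxx in cd'.
have q'z : dom q' z.
  by apply: domq => //; apply/negP => /onestr q'E; rewrite q'E eqxx in qq'.
have ndq' a : D q a -> ~~ dom q' a.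
  move=> qa; apply/negP => /dominates_pred/(_ qa qq').
  by rewrite dominates_root.
have nqm : ~~ D q m.
  apply/negP => /ndq'/negP[]; apply: (dominates_pred q'z cz).
  by rewrite eq_sym; exact: qT.
have outq r : D q r -> r \in [:: y; q'].
  move=> qr; rewrite !inE; apply/norP => -[ry rq'].
  have rm : r != m by apply: contraNneq nqm => <-.
  have rz : r != z.
    by apply: contraTneq qr => ->; move: qstr; rewrite !inE => /and3P[].
  have /negP[] := ndq' r qr.
  have [zr|nzr] := boolP (D z r).
    have := dominates_chain D_strong (zlast r ry rm zr) q'z rq'.
    by rewrite dominates_root.
  have [rz'|nrz] := boolP (D r z); first exact: dominates_pred q'z rz' rq'.
  have rq : r = q by apply: onestr; rewrite !inE rz nzr nrz.
  by rewrite rq D_irr in qr.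
have q'y : D q' y by apply: inT; [exact: neq'|exact: qT].
have qy : D q y by apply: inT; [exact: neq'|exact: qT].
have nmq : ~~ D m q.
  apply/negP => mq; apply: (@no_parity (w m q)) => s Ps Us sm.
  have avoid t : path D y t -> uniq (y :: t) -> last y t = m -> q \notin t ->
      parity w y t = w m q.
    move=> Pt Ut tm qt; have := @path_even _ _ _ _ w_odd w_in (rcons t q).
    rewrite rcons_path last_rcons parity_rcons tm Pt mq qy.
    rewrite -rcons_cons rcons_uniq inE negb_or qt Ut (neq qy).
    by move=> /(_ isT isT isT); case: (parity _ _ _); case: (w m q).
  have [qs|] := boolP (q \in s); last exact: avoid.
  case: s => [//|a s] in Ps Us sm qs *.
  move: (Ps) => /= /andP[/outy aQ Pa].
  have [qa|aq] := eqVneq a q; last first.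
    move: aQ Us Pa; rewrite !inE (negbTE aq) /= => /eqP aE; subst a.
    move: qs; rewrite inE eq_sym (negbTE aq) /= => qs; case/splitPr: qs sm Ps => s1 s2.
    rewrite -cat_cons last_cat cat_path /= => sm /and3P[_ _ P2].
    case: s2 => [|u s2] in sm P2 *; first by move: (qT q yq); rewrite -[q]/(last q [::]) sm eqxx.
    case/andP: P2 => /outq; rewrite !inE => /orP[]/eqP-> _ U.
      by rewrite mem_cat !inE eqxx !orbT in U.
    by move: U => /and3P[_ ]; rewrite mem_cat !inE eqxx !orbT.
  subst a; case: s => [|u s] in Ps Us sm qs Pa *.
    by move: sm => /= qm; move: (qT q yq); rewrite qm eqxx.
  case/andP: (Pa) => qu Pu; move/outq: (qu); rewrite !inE => /orP[]/eqP uE; subst u.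
    by move: Us; rewrite /= !inE eqxx orbT.
  have /= <- := avoid (q' :: s).
  - by rewrite !w_out // (root_arc_even D_irr w_odd w_out w_in yq qu).
  - by rewrite /= yq'.
  - by move: Us; rewrite /= inE negb_or => /andP[/andP[_ ->] /andP[_ ->]].
  - exact: sm.
  - by move: Us => /= /and3P[].
have qm : q \in strangers D m by rewrite !inE qT // nmq.
have ym : y \in strangers D m by rewrite !inE eq_sym my nmy.
have [c [+ cz' cd']] := near_partner2 z d (D_near me) qm ym (neq qy).
rewrite inE => /andP[mc cm].
have cy : c != y by apply: contraNneq nmy => <-.
have dm' : dom d m by apply: dominates_pred ddz cz _; rewrite eq_sym.
have dc : dom d c := dominates_pred dm' cm cd'.
have ncz : ~~ dom c z.
  apply/negP => cz0; apply: (dominates_asym D_strong dc).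
  by apply: dominates_pred cz0 dz _; rewrite eq_sym.
have nzc : ~~ D z c by apply: contra ncz => zc0; apply: zlast => //; exact: neq'.
have czD : D c z.
  apply: contraT => ncz'; have cq : c = q by apply: onestr; rewrite !inE cz' nzc ncz'.
  by rewrite cq (negbTE nmq) in mc.
have [s [Ps Us sd]] := root_path y D_strong d.
have zs : z \notin s := path_to_dominator Ps Us sd ddz.
have wcz : w c z = false.
  apply: detour_arc_even => //; exact: last_not_dominates.
exfalso; apply: (no_detour D_irr w_odd w_in zc mc czD _ zy' wcz (s := rcons s z)) => //.
- by apply: inT => //; exact: neq.
- by rewrite rcons_path Ps sd.
- by rewrite -rcons_cons rcons_uniq inE negb_or zy zs.
- by rewrite last_rcons.
- by rewrite mem_rcons inE negb_or cz' (path_to_dominator Ps Us sd).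
- by rewrite mem_rcons inE negb_or eq_sym zm (path_to_dominator Ps Us sd).
Qed.

(** The last vertex [z] of [two_partners] is now the out-neighbour [p] of the root. Let
    [x] be the last of the vertices other than [y], [p] and [m]. If [x] is not [v], it
    sends arcs to [p] and to [m], and for an out-neighbour [c] of [m] there is an even
    path [c .. x]; then the cycle [x p m c .. x] is even, as [y p m c .. x y] is odd. If
    [x] is [v], then the paths to [m] are so few that [both_parities] determines the
    out-neighbours of [m], and no vertex is left besides [y], [p], [m] and [v]. *)
Lemma two_partners_root p v : D y p -> D y v -> p != v ->
  (forall u, D y u -> u \in [:: p; v]) -> (forall u, D p u -> u \in [:: y; m]) ->
  D p m -> ~~ dom p m -> C4_like D.
Proof.
move=> yp yv pv outy outp pm npm.
have qT t : D y t -> t != m by move=> yt; apply: contraNneq nym => <-.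
have py : D p y by apply: inT; [exact: neq'|exact: qT].
have vy : D v y by apply: inT; [exact: neq'|exact: qT].
have yp' := neq yp; have pm' := neq pm; have yv' := neq yv; have vm' := qT v yv.
pose X := [set t | t \notin [:: y; p; m]].
have XE t : (t \in X) = [&& t != y, t != p & t != m] by rewrite !inE !negb_or.
have Xy t : t \in X -> D t y by rewrite XE => /and3P[a _ b]; apply: inT.
have vX : v \in X by rewrite XE; neqs.
have [//|x xX xlast] := last_in D_irr w_odd w_in vX.
have mX c : D m c -> c != p -> c \in X.
  move=> mc cp; rewrite XE cp (neq' mc) !andbT.
  by apply: contraNneq nmy => <-.
have nret c : D m c -> ~~ D c p.
  move=> mc; apply/negP => cp.
  have cX := mX c mc (neq cp); move: (cX); rewrite XE => /and3P[c1 c2 c3].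
  apply: (no_detour D_irr w_odd w_in pm mc cp (Xy c cX) py _ (s := [:: p])) => //=.
  - exact: detour_arc_even.
  - by rewrite yp.
  - neqs.
  - neqs.
  - neqs.
have [xv|xv] := eqVneq x v; last first.
  move: (xX); rewrite XE => /and3P[xy xp xm].
  have xe : x != e by have := outy e ye; rewrite !inE => /orP[]/eqP->.
  have nyx : ~~ D y x by apply/negP => /outy; rewrite !inE (negbTE xp) (negbTE xv).
  have npx : ~~ D p x by apply/negP => /outp; rewrite !inE (negbTE xy) (negbTE xm).
  have inX c : D c x -> c != m -> c \in X.
    move=> cx cm; rewrite XE cm andbT.
    by apply/andP; split; [apply: contraNneq nyx => <-|apply: contraNneq npx => <-].
  have [mx|nmx] := boolP (D m x).
    have pstr : p \in strangers D x by rewrite !inE eq_sym xp npx nret.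
    have [c] := near_partner m (D_near xe) pstr; rewrite inE => /andP[xc cx] cm.
    have cX := inX c cx cm; have cp : c != p by move: cX; rewrite XE => /and3P[].
    have := dominates_pred (dominates_pred (xlast c cX xc) mx _) pm.
    by rewrite dominates_root // eq_sym cm eq_sym cp => /(_ isT isT).
  have adj u : u != x -> ~~ D x u -> D u x.
    move=> ux; apply: dominated_adjacent => // c xc cx; apply: xlast => //.
    by apply: inX => //; apply: contraNneq nmx => <-.
  have xp' : D x p by apply: (contraNT _ npx); apply: adj; rewrite eq_sym.
  have [c mc cp] := D_out2 m p; have cX := mX c mc cp.
  move: (cX); rewrite XE => /and3P[cy _ cm].
  have cx : c != x by apply: contraNneq nmx => <-.
  have [s [Ps Us sx]] : exists s, [/\ path D c s, uniq (c :: s), last c s = x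
      & forall u, u \in [:: y; p; m] -> u \notin s].
    have [cx'|ncx] := boolP (D c x).
      exists [:: x]; split=> //=; first by rewrite cx'.
        neqs.
      by move=> u; rewrite !inE => /or3P[]/eqP->; rewrite eq_sym.
    have xc : D x c by apply: (contraNT _ ncx); apply: adj.
    have dcx := xlast c cX xc.
    have [s [Ps Us sx ds]] := dominates_path D_strong dcx; exists s; split=> // u.
    rewrite !inE => uE; apply/negP => /(allP ds).
    case/or3P: uE => /eqP->; rewrite ?dominates_y ?(dominates_root _ yp) //.
    move=> dcm; have := dominates_pred dcm pm; rewrite dominates_root // eq_sym.
    by move=> /(_ cp).
  move=> avoid; have [ys ps ms] : [/\ y \notin s, p \notin s & m \notin s].
    by split; apply: avoid; rewrite !inE eqxx ?orbT.
  have U : uniq (y :: p :: m :: c :: s).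
    by move: Us => /= /andP[? ?]; neqs.
  have := path_even w_odd w_in _ U; rewrite /= yp pm mc Ps sx (Xy x xX) w_out //=.
  move=> /(_ isT isT) E; have /andP[_ U'] := U.
  have := w_odd U'; rewrite rcons_path parity_rcons /= pm mc Ps sx xp' E.
  rewrite (arc_even D_irr w_odd w_in xp' (Xy x xX) py) => [/(_ isT)//|].
  rewrite -sx; apply: connect_trans (walk_avoid Ps ps).
  apply: reach_step mc cp; apply: not_dominates => //.
  exact: neq'.
subst x; have outv u : D v u -> u \in [:: y; p; m].
  move=> vu; apply: contraT => nu; have := xlast u; rewrite inE nu vu => /(_ isT isT).
  by rewrite dominates_root.
have [vm wvm] : D v m /\ w v m != w p m.
  suff: ~~ (D v m ==> (w v m == w p m)) by rewrite negb_imply => /andP.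
  apply/negP => /implyP wvm; apply: (@no_parity (w p m)) => s Ps Us sm.
  have fin t : uniq (m :: t) -> last m t = m -> t = [::].
    case: t => //= a t /andP[mt _] lm; case/negP: mt; rewrite -{1}lm; exact: mem_last.
  have viap t : path D p t -> y \notin t -> uniq t -> last p t = m -> parity w p t = w p m.
    case: t => [|a t] /=; first by move=> _ _ _ E; rewrite E eqxx in pm'.
    case/andP=> /outp; rewrite !inE => /orP[]/eqP-> _; first by rewrite eqxx.
    by move=> _ Ut lm; rewrite (fin t Ut lm) /= addbF.
  case: s => [|a s] in Ps Us sm *; first by move: my; rewrite -sm eqxx.
  move: Ps Us => /= /andP[/outy aQ Ps]; rewrite inE negb_or => /and3P[/andP[_ ys] as_ Us].
  rewrite w_out; last by move: aQ; rewrite !inE => /orP[]/eqP->.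
  move: aQ; rewrite !inE => /orP[]/eqP aE; subst a; first exact: viap.
  case: s => [|b s] in Ps ys as_ Us sm *; first by move: vm'; rewrite -sm eqxx.
  move: Ps ys => /= /andP[vb Ps]; rewrite inE negb_or => /andP[yb ys].
  move/outv: (vb); rewrite !inE eq_sym (negbTE yb) /= => /orP[]/eqP bE; subst b.
    rewrite (root_arc_even D_irr w_odd w_out w_in yv vb) //.
    by apply: viap => //; case/andP: Us.
  by rewrite (fin s Us sm) /= addbF; apply/eqP/wvm.
have outm u : D m u -> u \in [:: p; v].
  move=> mu; rewrite !inE; apply/norP => -[up uv].
  have uX := mX u mu up; move: (uX); rewrite XE => /and3P[uy _ um].
  have E q : D y q -> D q m -> u != q -> w q m = w m u.
    move=> yq qm uq; have [qy' qm'] := (neq yq, neq qm).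
    have U : uniq [:: y; q; m; u] by neqs.
    have := path_even w_odd w_in _ U; rewrite /= yq qm mu (Xy u uX) w_out //.
    by move=> /(_ isT isT); case: (w q m); case: (w m u).
  by rewrite !E ?eqxx in wvm.
have mp : D m p.
  by have [b mb] := D_out2 m v; move/outm: (mb); rewrite !inE => /orP[]/eqP bE; rewrite bE ?eqxx // -bE.
have mv : D m v.
  by have [b mb] := D_out2 m p; move/outm: (mb); rewrite !inE => /orP[]/eqP bE; rewrite bE ?eqxx // -bE.
have nvp := nret v mv.
exists y, p, m, v; split; first by neqs.
  move=> u; have /connectP[s Ps ->] := D_strong y u.
  suff H a : path D a s -> a \in [:: y; p; m; v] -> last a s \in [:: y; p; m; v].
    by apply: H => //; rewrite inE eqxx.
  elim: s a {Ps} => //= b s IH a /andP[ab Ps] ain; apply: IH => //.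
  move: ain ab; rewrite !inE => /or4P[]/eqP->.
  - by move/outy; rewrite !inE => /orP[]->; rewrite ?orbT.
  - by move/outp; rewrite !inE => /orP[]->; rewrite ?orbT.
  - by move/outm; rewrite !inE => /orP[]->; rewrite ?orbT.
  - by move/outv; rewrite !inE => /or3P[]->; rewrite ?orbT.
split=> u; apply/idP/idP; rewrite ?inE.
- by move/outy; rewrite !inE.
- by case/orP=> /eqP->.
- by move/outp; rewrite !inE.
- by case/orP=> /eqP->.
- by move/outm; rewrite !inE.
- by case/orP=> /eqP->.
- move=> vu; have := outv u vu; rewrite !inE => /or3P[]/eqP uE; subst u.
  + by rewrite eqxx.
  + by case/negP: nvp.
  + by rewrite eqxx orbT.
- by case/orP=> /eqP->.
Qed.

(** The last vertex [z] has no dominator by [two_partners_dominator], so that its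
    out-neighbours are [y] and [m]. If [z] is not an out-neighbour of [y], then
    [no_detour] with [z m c z] and a suitable out-neighbour of [y] excludes all
    out-neighbours [c] of [m] other than [z]. *)
Lemma two_partners p v : D y p -> D y v -> p != v ->
  (forall u, D y u -> u \in [:: p; v]) -> C4_like D.
Proof.
move=> yp yv pv outy.
have qT t : D y t -> t != m by move=> yt; apply: contraNneq nym => <-.
have outyC u : D y u -> u \in [:: v; p].
  by move/outy; rewrite !inE orbC.
pose S := [set t | (t != y) && (t != m)].
have [||z zS zlast] := last_in D_irr w_odd w_in (S := S) (x := p).
- by rewrite inE qT // neq'.
- by move=> t; rewrite inE => /andP[]; apply: inT.
have {zS} [zy zm] : z != y /\ z != m by move: zS; rewrite inE => /andP[].
have {}zlast t : t != y -> t != m -> D z t -> dom t z.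
  by move=> a b; apply: zlast; rewrite inE a.
have zy' := inT zy zm.
have nzm := last_not_dominates zy' zlast.
have [/existsP[d dz]|] := boolP [exists d, dom d z].
  have pz := two_partners_dominator yp yv pv outy zy zm zlast dz.
  have vz : dom v z.
    by apply: (two_partners_dominator yv yp _ outyC zy zm zlast dz); rewrite eq_sym.
  by have := root_not_dominating z D_strong yp yv pv; rewrite pz vz.
move=> /existsPn nodom.
have outz t : D z t -> t \in [:: y; m].
  move=> zt; rewrite !inE; apply/norP => -[ty tm].
  by have := nodom t; rewrite zlast.
have zm' : D z m.
  by have [b zb] := D_out2 z y; move/outz: (zb); rewrite !inE => /orP[]/eqP bE; rewrite bE ?eqxx // -bE.
have [yz|nyz] := boolP (D y z).
  have := outy z yz; rewrite !inE => /orP[]/eqP zE; subst z.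
    exact: (two_partners_root yp yv pv outy outz zm' nzm).
  by apply: (two_partners_root yv yp _ outyC outz zm' nzm); rewrite eq_sym.
have ze : z != e by apply: contraNneq nyz => ->.
have adj u : u != z -> u != y -> u != m -> D u z.
  move=> uz uy um; apply: (near_adjacent (D_near ze)) => //.
    move=> c c'; rewrite !inE => /andP[/outz + cz] /andP[/outz + c'z].
    rewrite !inE => /orP[]/eqP cE /orP[]/eqP c'E; subst c c' => //.
      by rewrite (negbTE nyz) in cz.
    by rewrite (negbTE nyz) in c'z.
  by apply/negP => /outz; rewrite !inE (negbTE uy) (negbTE um).
have [c mc cz] := D_out2 m z.
have cy : c != y by apply: contraNneq nmy => <-.
have cm := neq' mc; have cz' := adj c cz cy cm.
have qz q : D y q -> D q z.
  move=> yq; apply: adj; [by apply: contraNneq nyz => <-|exact: neq'|exact: qT].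
have [q yq qc] : exists2 q, D y q & q != c.
  by have [->|pc] := eqVneq c p; [exists v; rewrite // eq_sym|exists p; rewrite // eq_sym].
exfalso; apply: (no_detour D_irr w_odd w_in zm' mc cz' (inT cy cm) zy' _ (s := [:: q; z])) => //=.
- exact: detour_arc_even.
- by rewrite yq qz.
- by have [? ?] := (neq yq, neq (qz q yq)); neqs.
- neqs.
- by have ? := qT q yq; neqs.
Qed.

End TwoPartners.

End Core.

Lemma outdegree2_case (V : finType) (D : rel V) (e y q : V) :
  irreflexive D -> strong D -> noneven D -> (forall x, x != e -> near D x) ->
  out2 D -> y != e -> D y e -> (forall u, D y u -> u \in [:: e; q]) ->
  W4_like D \/ C4_like D.
Proof.
move=> D_irr D_strong D_noneven D_near D_out2 nye ye outy.
have /nonevenP[w0 /(normalized_weighting y D_irr)] := D_noneven.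
case=> w [w_odd w_out w_in].
have yq : D y q.
  by have [b yb] := D_out2 y e; move/outy: (yb); rewrite !inE => /orP[]/eqP bE; rewrite bE ?eqxx // -bE.
have eq : e != q.
  by have [b /outy] := D_out2 y e; rewrite !inE => /orP[]/eqP->; rewrite ?eqxx // eq_sym.
have outy' u : D y u -> u \in [:: q; e] by move/outy; rewrite !inE orbC.
have adj : ~~ (D e y && D q y) -> forall t, t != y -> ~~ D y t -> D t y.
  move=> n2 t ty; apply: near_adjacent => //; first exact: D_near.
  move=> c c'; rewrite !inE => /andP[/outy cQ cy] /andP[/outy c'Q c'y].
  by move: cQ c'Q n2; rewrite !inE => /orP[]/eqP cE /orP[]/eqP c'E; subst c c'; rewrite ?cy ?c'y.
have [ey|ney] := boolP (D e y); have [qy|nqy] := boolP (D q y).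
- have [/existsP[m mS]|] := boolP [exists m, m \in strangers D y].
    right; move: (mS); rewrite inE => /and3P[my nym nmy].
    apply: (two_partners D_irr D_strong w_odd w_out w_in D_near D_out2 ye my nmy nym _ ye yq eq outy).
    move=> t ty tm; apply: contraT => nty.
    have tS : t \in strangers D y.
      rewrite inE ty nty andbT; apply: contra nty => /outy.
      by rewrite !inE => /orP[]/eqP->.
    have mt : m != t by rewrite eq_sym.
    have [c [+ ce cq]] := near_partner2 e q (D_near y nye) mS tS mt.
    rewrite inE => /andP[/outy + _].
    by rewrite !inE (negbTE ce) (negbTE cq).
  move=> /existsPn noS; exfalso.
  apply: (@not_all_in V D y e) => // t ty; apply: contraT => nty.
  case/negP: (noS t); rewrite inE ty nty andbT; apply: contra nty => /outy.
  by rewrite !inE => /orP[]/eqP->.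
- left; have {}adj : forall t, t != y -> ~~ D y t -> D t y.
    by apply: adj; rewrite (negbTE nqy) andbF.
  apply: (one_partner D_irr D_strong w_odd w_out w_in D_near D_out2 ye outy) => //.
  move=> t; rewrite !inE negb_or => /andP[ty tq]; have [yt|] := boolP (D y t); last exact: adj.
  by move/outy: yt; rewrite !inE (negbTE tq) orbF => /eqP->.
- left; have {}adj : forall t, t != y -> ~~ D y t -> D t y.
    by apply: adj; rewrite (negbTE ney).
  apply: (one_partner D_irr D_strong w_odd w_out w_in D_near D_out2 ye outy') => //.
    move=> t; rewrite !inE negb_or => /andP[ty tq]; have [yt|] := boolP (D y t); last exact: adj.
    by move/outy: yt; rewrite !inE (negbTE tq) => /eqP->.
  by rewrite eq_sym.
- have {}adj : forall t, t != y -> ~~ D y t -> D t y.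
    by apply: adj; rewrite (negbTE ney).
  exfalso; apply: (no_partner_false D_irr D_strong w_odd w_out w_in D_near D_out2 ye (p := e) (v := q)).
  split; split=> // t; rewrite !inE !negb_or => /and3P[ty te tq]; apply: adj => //.
  by apply/negP => /outy; rewrite !inE (negbTE te) (negbTE tq).
Qed.

(** * Contraction onto a terminal component *)
Lemma first_in (T : eqType) (p : pred T) s : has p s ->
  exists s1 a s2, [/\ s = s1 ++ a :: s2, p a & all (predC p) s1].
Proof.
elim: s => //= b s IH; have [pb _|npb /= /IH[s1 [a [s2 [-> pa ps]]]]] := boolP (p b).
  by exists [::], b, s.
by exists (b :: s1), a, s2; rewrite /= npb.
Qed.

Lemma parity_map (V W : finType) (f : W -> V) w a s :
  parity w (f a) (map f s) = parity (fun u v => w (f u) (f v)) a s.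
Proof. by elim: s a => //= b s IH a; rewrite IH. Qed.

Lemma noneven_inj (V W : finType) (D : rel V) (E : rel W) (f : W -> V) :
  injective f -> (forall u v, E u v -> D (f u) (f v)) -> noneven D -> noneven E.
Proof.
move=> injf sub /nonevenP[w w_odd]; apply/nonevenP.
exists (fun u v => w (f u) (f v)) => a s Us Ps.
rewrite -parity_map map_rcons; apply: w_odd; first by rewrite -map_cons map_inj_uniq.
rewrite -map_rcons path_map; apply: sub_path Ps => u v; exact: sub.
Qed.

Lemma connect_sig (V : finType) (D : rel V) (K : {set V}) (E : rel {x | x \in K}) :
  (forall u v, D (val u) (val v) -> E u v) -> forall u v : {x | x \in K},
  connect [rel a b | [&& a \in K, b \in K & D a b]] (val u) (val v) -> connect E u v.
Proof.
move=> sub u v /connectP[s Ps]; elim: s u Ps => [|b s IH] u /=.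
  by move=> _ /val_inj->; apply: connect0.
case/andP=> /and3P[_ bK ub] Ps lv.
apply: connect_trans (connect1 (y := exist _ b bK) _) _; first exact: sub.
exact: IH.
Qed.

Section Component.
Variables (V : finType) (D : rel V) (e : V).
Hypotheses (D_irr : irreflexive D) (D_strong : strong D).

(** [K] is a strong component of [D - e] without arcs to other components. *)
Definition terminal (K : {set V}) :=
  [/\ e \notin K, exists k, k \in K,
      forall u v, u \in K -> D u v -> v \in K \/ v = e
    & forall u v, u \in K -> v \in K ->
        connect [rel a b | [&& a \in K, b \in K & D a b]] u v].

(** Take the vertices reached from a vertex of [D - e] that reaches as few vertices
    as possible. *)
Lemma terminal_exists k : k != e -> exists K, terminal K.
Proof.
move=> ke; pose G := [rel a b | D a b && (b != e)].
case: (arg_minnP (fun z => #|connect G z|) (ke : (predC1 e) k)) => z ze zmin.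
have Ge u v : u != e -> connect G u v -> v != e.
  move=> ue /connectP[s Ps ->]; elim: s u ue Ps => //= b s IH a ae.
  by case/andP=> /andP[_ be]; apply: IH.
have back u : connect G z u -> connect G u z.
  move=> zu; have sub : connect G u \subset connect G z.
    by apply/subsetP => v; rewrite !inE; apply: connect_trans.
  have : connect G u =i connect G z.
    apply/subset_cardP => //; apply/eqP; rewrite eqn_leq subset_leq_card // zmin //.
    exact: Ge zu.
  by move=> /(_ z); rewrite !inE connect0.
exists [set u | connect G z u]; split.
- by rewrite inE; apply/negP => /(Ge _ _ ze); rewrite eqxx.
- by exists z; rewrite inE connect0.
- move=> u v; rewrite !inE => zu uv; have [|ve] := eqVneq v e; [by right|left].
  by apply: connect_trans zu (connect1 _); rewrite /= uv.
move=> u v; rewrite !inE => zu zv.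
have /connectP[s Ps ->] := connect_trans (back u zu) zv.
elim: s u zu Ps => [|b s IH] u zu //= /andP[ub Ps].
have zb : connect G z b by exact: (connect_trans zu (@connect1 _ G u b ub)).
apply: connect_trans (IH b zb Ps); apply: connect1; rewrite /= !inE zu zb.
by case/andP: ub.
Qed.

Variable K : {set V}.
Hypothesis K_term : terminal K.

(** The first vertices in [K] of the paths from [e]. *)
Definition entry a := a \in K /\ exists s,
  [/\ path D e (rcons s a), uniq (e :: s) & all (fun u => u \notin K) (e :: s)].

Lemma entry_arc a : a \in K -> D e a -> entry a.
Proof.
case: K_term => eK _ _ _ aK ea; split=> //; exists [::].
by rewrite /= ea eK.
Qed.

Lemma entry_exists : exists a, entry a.
Proof.
case: K_term => eK [k kK] _ _; have [s [Ps Us sk]] := root_path e D_strong k.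
have /first_in[s1 [a [s2 [sE aK s1K]]]] : has (mem K) s.
  apply/hasP; exists k => //; have := mem_last e s; rewrite sk inE.
  by case/predU1P=> // ke; rewrite -ke kK in eK.
exists a; split=> //; exists s1; split.
- by move: Ps; rewrite sE -cat_rcons cat_path => /andP[].
- by move: Us; rewrite sE -cat_cons cat_uniq => /and3P[].
- by rewrite /= eK.
Qed.

Lemma exit_exists : exists2 t, t \in K & D t e.
Proof.
case: K_term => eK [k kK] closed _.
have [/exists_inP[t tK te]|/exists_inPn nt] := boolP [exists t in K, D t e].
  by exists t.
have /connectP[s Ps lek] := D_strong k e; case/negP: eK; rewrite lek.
elim: s k kK Ps {lek} => //= b s IH k kK /andP[kb Ps]; apply: IH Ps.
by have [//|be] := closed k b kK kb; move: (nt k kK); rewrite -be kb.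
Qed.

(** The arcs from [K] to [e] are redirected to [a], without creating a loop. *)
Definition contract a : rel {x | x \in K} := fun u v =>
  D (val u) (val v) || [&& val u != a, D (val u) e & val v == a].

Lemma contract_irreflexive a : irreflexive (contract a).
Proof.
move=> u; rewrite /contract D_irr /=; apply/negP => /and3P[ua _].
by rewrite (negbTE ua).
Qed.

Lemma contract_strong a : strong (contract a).
Proof.
case: K_term => _ _ _ conn u v; apply: (connect_sig (D := D)).
  by move=> x x' xx'; rewrite /contract xx'.
by apply: conn; apply: valP.
Qed.

(** An arc [u -> a] of the contraction stands for the walk that goes from [u] to [e] and
    from there to [a] outside [K], so that cycles lift to cycles. *)
Lemma contract_noneven a : entry a -> noneven D -> noneven (contract a).
Proof.
case=> aK [P [PP UP PK]] /nonevenP[w w_odd].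
pose E u v := [&& u \in K, v \in K & D u v || [&& u != a, D u e & v == a]].
suff: noneven E.
  apply: (noneven_inj val_inj) => u v uv.
  by rewrite /E (valP u) (valP v).
apply/nonevenP.
pose w' u v := if D u e && (v == a) then w u e (+) parity w e (rcons P a) else w u v.
exists w'; have same b s : a \notin s -> path E b s ->
    [/\ path D b s, parity w' b s = parity w b s & all (mem K) s].
  elim: s b => //= c s IH b; rewrite inE negb_or eq_sym => /andP[ca cs].
  case/andP=> /and3P[_ cK]; rewrite (negbTE ca) !andbF orbF => bc Ps.
  have [-> -> ->] := IH c cs Ps.
  by rewrite bc cK /w' (negbTE ca) andbF.
apply: (@odd_weighting_rooted _ _ a).
  move=> s Us; have as_ : a \notin s by case/andP: Us.
  rewrite rcons_path parity_rcons => /andP[Ps /and3P[_ _ la]].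
  have [PD -> sK] := same a s as_ Ps; rewrite /w' eqxx andbT.
  have [le|nle] := boolP (D (last a s) e); last first.
    move: la; rewrite (negbTE nle) andbF orbF => la.
    by rewrite -parity_rcons; apply: w_odd; rewrite // rcons_path PD.
  have U : uniq (a :: s ++ e :: P).
    rewrite -cat_cons cat_uniq Us UP andbT; apply/hasPn => u uP /=.
    have := allP PK u uP; apply: contra; rewrite inE => /predU1P[->//|us].
    exact: (allP sK).
  have := w_odd _ _ U; rewrite rcons_cat /= cat_path /= PD le PP => /(_ isT).
  by rewrite parity_cat /=.
move=> b s ab Us Ps.
have nas : a \notin rcons s b by move: ab; rewrite inE mem_rcons inE.
have [PD -> _] := same b _ nas Ps; exact: w_odd.
Qed.

(** The only possible loss is the two-cycle of [u] with [e]. If [u] has no arc to [a] in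
    [D], it is made good by the new arc [u -> a], which creates a two-cycle or removes
    a stranger. *)
Lemma contract_near a (u : {x | x \in K}) : entry a -> near D (val u) -> val u != a ->
  (D (val u) e -> D e (val u) -> ~~ D (val u) a) -> near (contract a) u.
Proof.
move=> [aK _] nu ua loss; case: K_term => eK _ closed _.
have sub : forall x v, D (val x) (val v) -> contract a x v.
  by move=> x v xv; rewrite /contract xv.
have SS : val @: strangers (contract a) u \subset strangers D (val u).
  apply/subsetP => _ /imsetP[x + ->]; rewrite !inE => /and3P[xu ux xu'].
  by rewrite val_eqE xu (contra (sub _ _) ux) (contra (sub _ _) xu').
have PP : partners D (val u) :\ e \subset val @: partners (contract a) u.
  apply/subsetP => x; rewrite !inE => /and3P[xe ux xu].
  have [xK|xe'] := closed _ _ (valP u) ux; last by rewrite xe' eqxx in xe.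
  by apply/imsetP; exists (exist _ x xK) => //; rewrite inE !sub.
have cS := subset_leq_card SS; have cP := subset_leq_card PP.
rewrite !(card_imset _ val_inj) in cS cP.
have cE := cardsD1 e (partners D (val u)); rewrite inE in cE.
move: nu cE; rewrite /near.
have pred_mono s s' p p' : s' <= s -> p <= p' -> s <= p.-1 -> s' <= p'.-1 by lia.
case: (boolP (D (val u) e && D e (val u))) => [/andP[ue eu]|_] nu cE; last first.
  by rewrite add0n in cE; apply: pred_mono cS _ nu; rewrite cE.
rewrite add1n in cE.
have nua := loss ue eu.
pose a' : {x | x \in K} := exist _ a aK.
have ua' : contract a u a' by rewrite /contract /= ua ue eqxx orbT.
have [au|nau] := boolP (D a (val u)).
  have : a |: (partners D (val u) :\ e) \subset val @: partners (contract a) u.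
    apply/subsetP => x; rewrite in_setU1 => /predU1P[->|]; last exact: (subsetP PP).
    by apply/imsetP; exists a' => //; rewrite inE ua' sub.
  move/subset_leq_card; rewrite (card_imset _ val_inj) cardsU1 !inE (negbTE nua) andbF.
  by rewrite add1n => cP'; apply: pred_mono cS _ nu; rewrite cE.
have : val @: strangers (contract a) u \proper strangers D (val u).
  apply/properP; split=> //; exists a; first by rewrite !inE eq_sym ua nua.
  by apply/negP => /imsetP[x + xa]; rewrite inE -(val_inj (xa : val a' = val x)) ua' andbF.
have lt_mono s s' p p' : s' < s -> p <= p' -> s <= p.+1.-1 -> s' <= p'.-1 by lia.
move/proper_card; rewrite (card_imset _ val_inj) => cS'.
by apply: lt_mono cS' cP _; rewrite -cE.
Qed.

End Component.

(** * The digraphs without vertices of outdegree 1 *)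
Section Exceptions.
Variables (V : finType) (D : rel V).

Lemma exception_out : W4_like D \/ C4_like D ->
  forall x, exists b c, b != c /\ forall u, D x u = (u \in [:: b; c]).
Proof.
case=> -[y [m [p [z [U all4 [Ey Em Ep Ez]]]]]] x; have := all4 x.
  move: U; rewrite /= !inE !negb_or => /and4P[/and3P[ym yp yz] /andP[mp mz] pz _].
  move=> /or4P[]/eqP->; [exists m, p|exists p, z|exists z, y|exists y, m];
    by split=> //; rewrite eq_sym.
move: U; rewrite /= !inE !negb_or => /and4P[/and3P[ym yp yz] /andP[mp mz] pz _].
by move=> /or4P[]/eqP->; [exists m, z|exists y, p|exists m, z|exists y, p].
Qed.

Lemma exception_near : W4_like D \/ C4_like D -> forall x, near D x.
Proof.
case=> -[y [m [p [z [U all4 [Ey Em Ep Ez]]]]]] x.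
  have {}Ey u : D y u = (u \in [:: m; p]) := Ey u.
  have {}Em u : D m u = (u \in [:: p; z]) := Em u.
  have {}Ep u : D p u = (u \in [:: z; y]) := Ep u.
  have {}Ez u : D z u = (u \in [:: y; m]) := Ez u.
  rewrite /near; suff -> : strangers D x = set0 by rewrite cards0.
  apply/setP => u; rewrite !inE; apply/and3P => -[].
  have := all4 x; have := all4 u; rewrite !inE => /or4P[]/eqP-> /or4P[]/eqP->;
    by rewrite ?Ey ?Em ?Ep ?Ez !inE ?eqxx ?orbT.
have {}Ey u : D y u = (u \in [:: m; z]) := Ey u.
have {}Em u : D m u = (u \in [:: y; p]) := Em u.
have {}Ep u : D p u = (u \in [:: m; z]) := Ep u.
have {}Ez u : D z u = (u \in [:: y; p]) := Ez u.
move: U; rewrite /= !inE !negb_or => /and4P[/and3P[ym yp yz] /andP[mp mz] pz _].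
suff [o [b [c [bc xb cx oS]]]] : exists o b c, [/\ b != c, b \in partners D x,
    c \in partners D x & forall u, u \in strangers D x -> u = o].
  have S1 : #|strangers D x| <= 1.
    by rewrite -(cards1 o); apply/subset_leq_card/subsetP => u /oS->; rewrite inE.
  have P2 : 2 <= #|partners D x|.
    rewrite -[2]/(true.+1) -bc -cards2; apply/subset_leq_card/subsetP => u.
    by rewrite !inE => /orP[]/eqP->; [move: xb|move: cx]; rewrite inE.
  have arith s q : s <= 1 -> 2 <= q -> s <= q.-1 by lia.
  exact: arith.
have := all4 x; rewrite !inE => /or4P[]/eqP->;
  [exists p, m, z|exists z, y, p|exists y, m, z|exists m, y, p];
  split=> //; rewrite ?inE ?Ey ?Em ?Ep ?Ez ?inE ?eqxx ?orbT //;
  move=> u; have := all4 u; rewrite !inE => /or4P[]/eqP-> //;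
  by rewrite ?Ey ?Em ?Ep ?Ez ?inE ?eqxx ?orbT ?andbF.
Qed.

Hypotheses (D_irr : irreflexive D) (D_noneven : noneven D).

(** With weights normalised at [e], the arcs from the out-neighbours [y] and [m] of [e]
    to its in-neighbours [z] and [v] have weight 0 and the reversed arcs weight 1, so
    that the 4-cycle [y z m v] is even. *)
Lemma no_hub e y z m v : uniq [:: y; z; m; v] -> D y z -> D z y -> D y v -> D v y ->
  D m z -> D z m -> D m v -> D v m -> D e y -> D e m -> D z e -> D v e -> False.
Proof.
move=> U yz zy yv vy mz zm mv vm ey em ze ve.
have /nonevenP[w0 /(normalized_weighting e D_irr)] := D_noneven.
case=> w [w_odd w_out w_in].
have E := root_arc_even D_irr w_odd w_out w_in.
have T a b (ab : D a b) (ba : D b a) := two_cycle D_irr w_odd ab ba.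
have := w_odd _ _ U; rewrite /= yz zm mv vy => /(_ isT).
rewrite (E y z) // (E m v) //; have := T z m zm mz; rewrite (E m z) // addbF => ->.
by have := T v y vy yv; rewrite (E y v) // addbF => ->.
Qed.

(** With weights normalised at [e], the arcs between vertices of [S] have weight 0. *)
Lemma minimal_partner e (S : {set V}) x : x \in S ->
  (forall c, c \in S -> D e c && D c e) ->
  exists2 p, p \in S & forall c, c \in S -> ~~ D c p.
Proof.
move=> xS Se; have /nonevenP[w0 /(normalized_weighting e D_irr)] := D_noneven.
case=> w [w_odd w_out w_in].
have [|p pS pmin] := @sink_exists _ [rel a b | D b a] S x xS; last by exists p.
move=> z t zS tS /= tz; apply/negP.
rewrite (connect_rev [rel a b | [&& b \in S, a \in S & D a b]] t z) /=.
case/connectP => s0 P0 ez.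
case/shortenP: P0 ez => s Ps Us _ ez.
have H v s' : v \in S ->
    path [rel a b | [&& b \in S, a \in S & D a b]] v s' ->
    path D v s' /\ parity w v s' = false.
  elim: s' v => //= b s' IH v vS /andP[/and3P[bS _ vb] /(IH b bS)[-> ->]].
  have /andP[ev _] := Se v vS; have /andP[_ be] := Se b bS.
  by rewrite vb (root_arc_even D_irr w_odd w_out w_in ev vb be).
have [PD P0] := H z s zS Ps.
have := w_odd _ _ Us; rewrite rcons_path PD -ez tz => /(_ isT).
have /andP[et _] := Se t tS; have /andP[_ ze] := Se z zS.
by rewrite parity_rcons P0 -ez (root_arc_even D_irr w_odd w_out w_in et tz ze).
Qed.

End Exceptions.

Lemma out2_dec (V : finType) (D : rel V) :
  out2 D \/ exists x a, forall b, D x b -> b = a.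
Proof.
have [H|] := boolP [forall x, forall a, exists b, D x b && (b != a)].
  by left=> x a; have /existsP[b /andP[xb ba]] := forallP (forallP H x) a; exists b.
case/forallPn=> x /forallPn[a /existsPn H]; right; exists x, a => b xb.
by have := H b; rewrite xb /= negbK => /eqP.
Qed.

Section ExceptionAdjacency.
Variables (V : finType) (D : rel V).

Lemma W4_one_partner : W4_like D ->
  forall x, exists a, forall c, D x c -> D c x -> c = a.
Proof.
move=> [y [m [p [z [U all4 [Ey Em Ep Ez]]]]]] x.
have {}Ey u : D y u = (u \in [:: m; p]) := Ey u.
have {}Em u : D m u = (u \in [:: p; z]) := Em u.
have {}Ep u : D p u = (u \in [:: z; y]) := Ep u.
have {}Ez u : D z u = (u \in [:: y; m]) := Ez u.
move: U; rewrite /= !inE !negb_or => /and4P[/and3P[ym yp yz] /andP[mp mz] pz _].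
have ne := (negbTE ym, negbTE yp, negbTE yz, negbTE mp, negbTE mz, negbTE pz).
have := all4 x; rewrite !inE => /or4P[]/eqP->; [exists p|exists z|exists y|exists m] => c;
  have := all4 c; rewrite !inE => /or4P[]/eqP-> //;
  by rewrite ?Ey ?Em ?Ep ?Ez !inE ?eqxx ?ne // 1?eq_sym ?ne // 1?eq_sym ?ne // eq_sym ne.
Qed.

Lemma C4_stranger : C4_like D -> forall x, exists o, o \in strangers D x.
Proof.
move=> [y [m [p [z [U all4 [Ey Em Ep Ez]]]]]] x.
have {}Ey u : D y u = (u \in [:: m; z]) := Ey u.
have {}Em u : D m u = (u \in [:: y; p]) := Em u.
have {}Ep u : D p u = (u \in [:: m; z]) := Ep u.
have {}Ez u : D z u = (u \in [:: y; p]) := Ez u.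
move: U; rewrite /= !inE !negb_or => /and4P[/and3P[ym yp yz] /andP[mp mz] pz _].
have := all4 x; rewrite !inE => /or4P[]/eqP->; [exists p|exists z|exists y|exists m];
  rewrite !inE ?Ey ?Em ?Ep ?Ez !inE !negb_or; neqs.
Qed.

End ExceptionAdjacency.

(** The contraction [D'] of [D] onto a terminal component [K] of [D - e] has a vertex [x]
    of outdegree 1, or is an exception by induction. In the first case [e] and one more
    vertex are the out-neighbours of [x] in [D], as in [outdegree2_case]. The same
    happens in the second case for a vertex whose arc to [a] is new. Otherwise [D'] is
    the subdigraph induced by [K]. By the induction hypothesis the same holds for the
    contraction into any other entry, so that the in-neighbours of [e] in [K] are
    in-neighbours of all other entries. By density [e] is adjacent to all vertices of [K], and following the
    pairs of vertices without an arc one finds that [e] has no in-neighbours in [K] or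
    is placed as in [no_hub]. *)
Theorem out2_exceptions n (V : finType) (D : rel V) (e : V) : #|V| <= n ->
  irreflexive D -> strong D -> noneven D -> (forall x, x != e -> near D x) ->
  out2 D -> W4_like D \/ C4_like D.
Proof.
elim: n V D e => [|n IH] V D e cardV D_irr D_strong D_noneven D_near D_out2.
  by move: cardV; rewrite leqn0 => /eqP/card0_eq/(_ e).
have [k _ ke] := D_out2 e e.
have [K K_term] := terminal_exists D ke.
have [eK [k0 k0K] closed _] := K_term.
have neK x : x \in K -> x != e by apply: contraTneq => ->.
have cardK : #|{: {x | x \in K}}| <= n.
  rewrite card_sig -ltnS (leq_trans _ cardV) //.
  by apply: proper_card; apply/properP; split; [apply/subsetP|exists e].
have IHK a (aK : a \in K) : entry D e K a ->
    (forall u, u \in K -> u != a -> D u e -> D e u -> ~~ D u a) ->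
    out2 (@contract _ D e K a) ->
    W4_like (@contract _ D e K a) \/ C4_like (@contract _ D e K a).
  move=> aE loss; apply: (IH _ _ (exist _ a aK)) => //.
  - exact: contract_irreflexive.
  - exact: contract_strong.
  - exact: contract_noneven.
  - move=> x; rewrite -val_eqE /= => xa; apply: contract_near => //.
      exact: D_near (neK _ (valP x)).
    by apply: loss => //; exact: valP.
(* Among the partners of [e] in [K], one without arcs from the others is a good
   target; if there are none, any entry is. *)
have [a [aK aE loss]] : exists a, [/\ a \in K, entry D e K a
    & forall u, u \in K -> u != a -> D u e -> D e u -> ~~ D u a].
  have [/existsP[c /and3P[cK ec ce]]|] := boolP [exists c, [&& c \in K, D e c & D c e]].
    pose S := [set c in K | D e c && D c e].
    have [||p pS pmin] := minimal_partner D_irr D_noneven (e := e) (S := S) (x := c).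
    - by rewrite inE cK ec.
    - by move=> c'; rewrite inE => /andP[].
    move: pS; rewrite inE => /and3P[pK ep pe]; exists p; split=> //.
      exact: entry_arc.
    by move=> u uK _ ue eu; apply: pmin; rewrite inE uK ue eu.
  move/existsPn => noC; have [a aE] := entry_exists D_strong K_term.
  exists a; split=> //; first by case: aE.
  by move=> u uK _ ue eu; have := noC u; rewrite uK ue eu.
pose D' := @contract _ D e K a.
have subD (x v : {x | x \in K}) : D (val x) (val v) -> D' x v.
  by move=> xv; rewrite /D' /contract xv.
have [D'_out2|[x [r xr]]] := out2_dec D'; last first.
  apply: (@outdegree2_case _ D e (val x) (val r)) => //.
  - exact: neK (valP x).
  - have [b xb br] := D_out2 (val x) (val r).
    have [bK|<-//] := closed _ _ (valP x) xb.
    by case/eqP: br; rewrite -(xr (exist _ b bK)) //; exact: subD.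
  - move=> u xu; rewrite !inE; have [uK|->] := closed _ _ (valP x) xu; last by rewrite eqxx.
    by rewrite -(xr (exist _ u uK)) ?eqxx ?orbT //; exact: subD.
have D'_exc : W4_like D' \/ C4_like D' := IHK a aK aE loss D'_out2.
have [/existsP[x /and3P[xa xe nxa]]|] :=
    boolP [exists x : {x | x \in K}, [&& val x != a, D (val x) e & ~~ D (val x) a]].
  have [b [c [bc xbc0]]] := exception_out D'_exc x.
  have xbc u : D' x u = (u \in [:: b; c]) := xbc0 u.
  pose a' : {x | x \in K} := exist _ a aK.
  have xa' : D' x a' by rewrite /D' /contract /= xa xe eqxx orbT.
  have [r rE] : exists r, forall u, D' x u -> u \in [:: a'; r].
    move: xa'; rewrite xbc !inE => /orP[]/eqP a'E; subst; [exists c|exists b];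
      by move=> u; rewrite xbc !inE // orbC.
  apply: (@outdegree2_case _ D e (val x) (val r)) => //.
    exact: neK (valP x).
  move=> u xu; rewrite !inE; have [uK|->] := closed _ _ (valP x) xu; last by rewrite eqxx.
  have := rE (exist _ u uK) (subD x (exist _ u uK) xu); rewrite !inE -!val_eqE /=.
  by case/orP=> /eqP uE; [rewrite uE (negbTE nxa) in xu|rewrite uE eqxx orbT].
move/existsPn => noT.
have D'E x v : D' x v = D (val x) (val v).
  rewrite /D' /contract; case: (boolP (D _ _)) => //= nxv; apply/and3P => -[xa xe /eqP va].
  by have := noT x; rewrite xa xe -va nxv.
have D'_near := exception_near D'_exc.
(* Contracting into [b] again gives an exception, where the outdegrees are 2: the
   contraction cannot have added an arc. *)
have to_entry b x : entry D e K b -> x \in K -> D x e -> x != b -> D x b.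
  move=> bE xK xe xb; have [bK _] := bE.
  pose D2 := @contract _ D e K b; pose x' : {x | x \in K} := exist _ x xK.
  pose b' : {x | x \in K} := exist _ b bK.
  have sub : subrel D' D2 by move=> u v; rewrite D'E /D2 /contract => ->.
  have D2_exc : W4_like D2 \/ C4_like D2.
    apply: (IH _ _ x') => //.
    - exact: contract_irreflexive.
    - exact: contract_strong.
    - exact: contract_noneven.
    - by move=> u _; apply: near_subrel (D'_near u).
    - by move=> u c; have [v uv vc] := D'_out2 u c; exists v => //; apply: sub.
  have [b1 [c1 [bc1 xE1']]] := exception_out D'_exc x'.
  have xE1 u : D' x' u = (u \in [:: b1; c1]) := xE1' u.
  have [b2 [c2 [_ xE2']]] := exception_out D2_exc x'.
  have xE2 u : D2 x' u = (u \in [:: b2; c2]) := xE2' u.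
  have: D2 x' b' by rewrite /D2 /contract /= xb xe eqxx orbT.
  have: D2 x' b1 by apply: sub; rewrite xE1 !inE eqxx.
  have: D2 x' c1 by apply: sub; rewrite xE1 !inE eqxx orbT.
  rewrite -[D x b]/(D (val x') (val b')) -D'E xE1 !xE2 !inE.
  move=> /orP[]/eqP cE /orP[]/eqP bE' /orP[]/eqP b'E; move: bc1;
    by rewrite cE bE' b'E ?eqxx ?orbT.
have adj x : x \in K -> ~~ D x e -> D e x.
  move=> xK nxe; apply: contraT => nex; pose x' : {x | x \in K} := exist _ x xK.
  have eS : e \in strangers D x by rewrite inE eq_sym neK // nxe.
  have partK c : c \in partners D x -> exists2 c', c = val c' & D' x' c' /\ D' c' x'.
    rewrite inE => /andP[xc cx]; have [cK|ce] := closed _ _ xK xc.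
      by exists (exist _ c cK); rewrite ?D'E.
    by rewrite -ce xc in nxe.
  case: D'_exc => [/W4_one_partner/(_ x')[o oP]|D'_C4].
    have [c /partK[c' -> [xc cx]]] := near_partner (val o) (D_near _ (neK x xK)) eS.
    by rewrite (oP c') ?eqxx.
  have [o] := C4_stranger D'_C4 x'; rewrite inE !D'E -val_eqE => oS.
  have oS' : val o \in strangers D x by rewrite inE.
  have [b [c [_ xE']]] := exception_out (or_intror D'_C4) x'.
  have xE u : D' x' u = (u \in [:: b; c]) := xE' u.
  have eo : e != val o by rewrite eq_sym neK // (valP o).
  have [p [/partK[p' -> [+ _]]]] := near_partner2 (val b) (val c) (D_near _ (neK x xK)) eS oS' eo.
  by rewrite !val_eqE xE !inE => /orP[]/eqP->; rewrite eqxx.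
pose next (v : {x | x \in K}) := [/\ ~~ D (val v) e, D e (val v) & entry D e K (val v)].
have step (x v : {x | x \in K}) : v != x -> ~~ D' v x -> entry D e K (val x) -> next v.
  move=> vx nvx xE; have nve : ~~ D (val v) e.
    by apply: contra nvx => ve; rewrite D'E; apply: to_entry => //; exact: valP.
  have ev := adj _ (valP v) nve; split=> //; apply: entry_arc => //; exact: valP.
have [t tK te] := exit_exists D_strong K_term.
case: D'_exc => -[y [m [p [z [U all4 [Ey Em Ep Ez]]]]]].
  have {}Ey u : D' y u = (u \in [:: m; p]) := Ey u.
  have {}Em u : D' m u = (u \in [:: p; z]) := Em u.
  have {}Ep u : D' p u = (u \in [:: z; y]) := Ep u.
  have {}Ez u : D' z u = (u \in [:: y; m]) := Ez u.
  move: U; rewrite /= !inE !negb_or => /and4P[/and3P[ym yp yz] /andP[mp mz] pz _].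
  have S1 : entry D e K (val y) -> next m by apply: step; [neqs|rewrite Em; neqs].
  have S2 : entry D e K (val m) -> next p by apply: step; [neqs|rewrite Ep; neqs].
  have S3 : entry D e K (val p) -> next z by apply: step; [neqs|rewrite Ez; neqs].
  have S4 : entry D e K (val z) -> next y by apply: step; [neqs|rewrite Ey; neqs].
  exfalso; have yE : entry D e K (val y).
    have := all4 (exist _ a aK); rewrite !inE -!val_eqE /= => /or4P[]/eqP aE'; rewrite aE' in aE.
    - by [].
    - by case/S2: aE => _ _ /S3[_ _ /S4[]].
    - by case/S3: aE => _ _ /S4[].
    - by case/S4: aE.
  have [my _ mE] := S1 yE; have [py _ pE] := S2 mE.
  have [zy _ zE] := S3 pE; have [yy _ _] := S4 zE.
  have := all4 (exist _ t tK); rewrite !inE -!val_eqE /= => /or4P[]/eqP tE; move: te;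
    by rewrite tE; apply/negP.
have {}Ey u : D' y u = (u \in [:: m; z]) := Ey u.
have {}Em u : D' m u = (u \in [:: y; p]) := Em u.
have {}Ep u : D' p u = (u \in [:: m; z]) := Ep u.
have {}Ez u : D' z u = (u \in [:: y; p]) := Ez u.
move: (U); rewrite /= !inE !negb_or => /and4P[/and3P[ym yp yz] /andP[mp mz] pz _].
have S1 : entry D e K (val y) -> next p by apply: step; [neqs|rewrite Ep; neqs].
have S2 : entry D e K (val p) -> next y by apply: step; [neqs|rewrite Ey; neqs].
have S3 : entry D e K (val m) -> next z by apply: step; [neqs|rewrite Ez; neqs].
have S4 : entry D e K (val z) -> next m by apply: step; [neqs|rewrite Em; neqs].
have arcs : [/\ D (val y) (val m), D (val m) (val y), D (val y) (val z) & D (val z) (val y)]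
    /\ [/\ D (val p) (val m), D (val m) (val p), D (val p) (val z) & D (val z) (val p)].
  by split; rewrite -!D'E ?Ey ?Em ?Ep ?Ez !inE ?eqxx ?orbT.
case: arcs => [[A1 A2 A3 A4] [A5 A6 A7 A8]].
have exits (u v : {x | x \in K}) : next u -> next v -> t = val u \/ t = val v -> False.
  by move=> [nu _ _] [nv _ _] []tE; move: te; rewrite tE; apply/negP.
have tP : (t = val y \/ t = val p) \/ (t = val m \/ t = val z).
  by have := all4 (exist _ t tK); rewrite !inE -!val_eqE /= => /or4P[]/eqP; tauto.
have into (x : {x | x \in K}) : ~ entry D e K (val x) -> D (val x) e.
  by move=> nE; apply: contraT => /(adj _ (valP x)) ex; case: nE; apply: (entry_arc K_term (valP x) ex).
exfalso; have [yE|yE] : (next y /\ next p) \/ (next m /\ next z).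
- have := all4 (exist _ a aK); rewrite !inE -!val_eqE /= => /or4P[]/eqP aE'; rewrite aE' in aE.
  + by left; have pn := S1 aE; split=> //; apply: S2; case: pn.
  + by right; have pn := S3 aE; split=> //; apply: S4; case: pn.
  + by left; have pn := S2 aE; split=> //; apply: S1; case: pn.
  + by right; have pn := S4 aE; split=> //; apply: S3; case: pn.
- have [yn pn] := yE; have nm : ~ entry D e K (val m).
    move=> mE; have zn := S3 mE; have mn : next m by apply: S4; case: zn.
    by case: tP; apply: exits.
  have nz : ~ entry D e K (val z) by move=> zE; case: nm; case: (S4 zE).
  have [_ ey _] := yn; have [_ ep _] := pn.
  have Uv : uniq (map val [:: y; m; p; z]) by rewrite (map_inj_uniq val_inj).
  exact: (no_hub D_irr D_noneven Uv A1 A2 A3 A4 A5 A6 A7 A8 ey ep (into _ nm) (into _ nz)).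
have [mn zn] := yE; have ny : ~ entry D e K (val y).
  move=> mE; have pn := S1 mE; have yn : next y by apply: S2; case: pn.
  by case: tP; apply: exits.
have np : ~ entry D e K (val p) by move=> pE; case: ny; case: (S2 pE).
have [_ em _] := mn; have [_ ez _] := zn.
have Uv : uniq (map val [:: m; y; z; p]) by rewrite (map_inj_uniq val_inj); neqs.
exact: (no_hub D_irr D_noneven Uv A2 A1 A6 A5 A4 A3 A8 A7 em ez (into _ ny) (into _ np)).
Qed.

Lemma dense_near (V : finType) (D : rel V) : irreflexive D -> dense_digraph D ->
  forall x, near D x.
Proof.
move=> irr dD x; rewrite /near; case: dD => [semi|deg].
  suff -> : strangers D x = set0 by rewrite cards0.
  apply/setP => u; rewrite !inE; apply/and3P => -[ux xu xu'].
  by have := semi u x ux; rewrite (negbTE xu) (negbTE xu').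
pose A := [set u | D u x]; pose B := [set u | D x u].
have AB : A :|: B \subset ~: (x |: strangers D x).
  apply/subsetP => u; rewrite !inE negb_or !negb_and !negbK.
  by case: (eqVneq u x) => [->|_] /=; [rewrite irr|rewrite orbC].
have I : A :&: B = partners D x by apply/setP => u; rewrite !inE andbC.
have := subset_leq_card AB; have := cardsC (x |: strangers D x).
rewrite cardsU1 !inE eqxx /= add1n => cC cAB.
have dx : #|V| <= #|A| + #|B| := deg x.
have cUI := cardsUI A B; rewrite I in cUI; rewrite -cUI in dx.
have arith s n p u c : s.+1 + c = n -> u <= c -> n <= u + p -> s <= p.-1 by lia.
exact: arith cC cAB dx.
Qed.

(** * Deleting a vertex of outdegree 1 *)
Definition delete (V : finType) (D : rel V) (y : V) : rel {x | x \in [set~ y]} :=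
  fun u v => D (val u) (val v).
Arguments delete {V} D y _ _.

Section Delete.
Variables (V : finType) (D : rel V) (y p : V).
Hypotheses (D_irr : irreflexive D) (D_strong : strong D).
Hypothesis (outy : forall u, D y u = (u == p)).

(** Walks through [y] continue with [p], and can take the short cut to [p]. *)
Lemma delete_strong : (forall v, D v y -> v != p -> D v p) -> strong (delete D y).
Proof.
move=> via u v; apply: (connect_sig (D := D)) => //.
have /connectP[s Ps lv] := D_strong (val u) (val v).
have yp : y != p by apply/eqP => yp; have := D_irr y; rewrite outy yp eqxx.
have vy : val v != y by have := valP v; rewrite !inE.
have: val u != y by have := valP u; rewrite !inE.
move: (val u) (val v) vy Ps lv => {}u {}v vy.
pose E := [rel a b | [&& a \in [set~ y], b \in [set~ y] & D a b]].
have [n] := ubnP (size s); elim: n s u => // n IH [|b s] u /=.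
  by move=> _ _ -> _; apply: connect0.
rewrite ltnS => sn /andP[ub Ps] lv uy; have [by_|by_] := eqVneq b y; last first.
  apply: connect_trans (IH s b sn Ps lv by_); apply: connect1.
  by rewrite /= !inE uy by_.
subst b; case: s sn Ps lv => [|c s] /= sn Ps lv; first by rewrite lv eqxx in vy.
case/andP: Ps; rewrite outy => /eqP cp Ps; subst c.
have py : p != y by rewrite eq_sym.
have IHp := IH s p (ltnW sn) Ps lv py.
have [->//|up] := eqVneq u p; apply: connect_trans IHp; apply: connect1.
by rewrite /= !inE uy py via.
Qed.

Lemma delete_near : (forall v, v != y -> D v y) -> (forall v, v != y -> v != p -> D v p) ->
  (forall x, near D x) -> forall x, near (delete D y) x.
Proof.
move=> to_y to_p D_near x; have xy : val x != y by have := valP x; rewrite !inE.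
rewrite /near; have [xp|xp] := eqVneq (val x) p.
  suff -> : strangers (delete D y) x = set0 by rewrite cards0.
  apply/setP => u; rewrite !inE; apply/and3P => -[ux _ /negP[]].
  rewrite /delete xp; apply: to_p; first by have := valP u; rewrite !inE.
  by rewrite -xp val_eqE.
have SS : #|strangers (delete D y) x| <= #|strangers D (val x)|.
  rewrite -(card_imset _ val_inj); apply/subset_leq_card/subsetP => _ /imsetP[u + ->].
  by rewrite !inE val_eqE.
have PP : #|partners D (val x)| <= #|partners (delete D y) x|.
  rewrite -[X in _ <= X](card_imset _ val_inj); apply/subset_leq_card/subsetP => u.
  rewrite inE => /andP[xu ux]; have uy : u \in [set~ y].
    by rewrite !inE; apply: contraTneq ux => ->; rewrite outy.
  by apply/imsetP; exists (exist _ u uy) => //; rewrite inE /delete /= xu ux.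
have arith s s' q q' : s' <= s -> q <= q' -> s <= q.-1 -> s' <= q'.-1 by lia.
exact: arith SS PP (D_near _).
Qed.

End Delete.



(** * Growing and shrinking extended caterpillars *)

(** Numbering the backbone [X] and the blossoms [beta] by natural numbers, instead of
    ordinals whose bound changes, makes it easy to insert and delete vertices at the
    low end. *)
Section CaterpillarData.
Variables (V : finType) (k : nat) (X : nat -> V) (beta : V -> nat) (t : rel V).

Definition leaf u := u != X (beta u).

Definition caterpillar_arc u v :=
  [|| [&& ~~ leaf u, ~~ leaf v & (beta v == (beta u).+1) || (beta u == (beta v).+1)],
      [&& beta u == beta v & [|| leaf u && ~~ leaf v, ~~ leaf u && leaf v
                               | [&& leaf u, leaf v & t u v]]]
    | beta v < beta u].

Definition caterpillar_data :=
  [/\ 0 < k, forall j, j < k -> beta (X j) = j, forall u, beta u < k,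
      forall u, leaf u -> 0 < beta u /\ (beta u).+1 < k
    & [/\ forall u, leaf u -> ~~ t u u,
          forall u v, leaf u -> leaf v -> beta u = beta v -> u != v -> t u v (+) t v u
        & forall u v z, leaf u -> leaf v -> leaf z -> beta u = beta v -> beta z = beta v ->
            t u v -> t v z -> t u z]].

End CaterpillarData.

Lemma extended_caterpillarP (V : finType) (D : rel V) : extended_caterpillar D <->
  exists k X beta t, caterpillar_data k X beta t /\ D =2 caterpillar_arc X beta t.
Proof.
split.
  move=> [k [x [b [t [k0 xK bleaf tt DE]]]]].
  have [i0 _] : exists i : 'I_k, true by exists (Ordinal k0).
  pose X j := x (insubd i0 j); pose beta u := val (b u).
  have XE i : X (val i) = x i by rewrite /X valKd.
  have leafE u : leaf X beta u = (u \notin codom x).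
    rewrite /leaf /beta XE; congr (~~ _); apply/eqP/codomP => [E|[i ->]].
      by exists (b u).
    by rewrite xK.
  have tree u v : star (caterpillar_tree x b) u v =
      [&& ~~ leaf X beta u, ~~ leaf X beta v
        & (beta v == (beta u).+1) || (beta u == (beta v).+1)]
      || (beta u == beta v) && ((leaf X beta u && ~~ leaf X beta v)
           || (~~ leaf X beta u && leaf X beta v)).
    have onb u' v' : (u' \notin codom x) && (v' == x (b u')) =
       [&& leaf X beta u', ~~ leaf X beta v' & beta u' == beta v'].
      rewrite -leafE; congr (_ && _); rewrite /leaf negbK /beta XE.
      apply/eqP/andP => [->|[/eqP E /eqP bE]]; first by rewrite xK !eqxx.
      by rewrite E; congr x; apply: val_inj.
    rewrite /star /caterpillar_tree !onb -(negbK (u \in _)) -(negbK (v \in _)) -!leafE.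
    rewrite /beta; case: (leaf _ _ u); case: (leaf _ _ v) => //=;
      by rewrite ?andbF ?andbT ?orbF // eq_sym.
  exists k, X, beta, t; split; first split=> //.
  - by move=> j jk; rewrite /beta /X xK insubdK.
  - by move=> u; apply: ltn_ord.
  - by move=> u; rewrite leafE; apply: bleaf.
  - have inb u j : leaf X beta u -> b u = j -> u \in blossom_leaves x b j.
      by rewrite leafE inE => -> ->; rewrite eqxx.
    split.
    + move=> u lu; have [irr _ _] := tt (b u); apply: irr; exact: inb.
    + move=> u v lu lv /val_inj buv uv; have [_ tot _] := tt (b u).
      by apply: tot => //; apply: inb.
    + move=> u v z lu lv lz /val_inj buv /val_inj bzv; have [_ _ tr] := tt (b v).
      by apply: tr; apply: inb.
  - move=> u v; rewrite DE /extended_caterpillar_arc tree /caterpillar_arc.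
    have -> : [exists j, [&& u \in blossom_leaves x b j, v \in blossom_leaves x b j & t u v]]
       = [&& beta u == beta v, leaf X beta u, leaf X beta v & t u v].
      rewrite !leafE; apply/existsP/and4P => [[j /and3P[]]|[/eqP/val_inj buv lu lv tuv]].
        by rewrite !inE => /andP[-> /eqP bu] /andP[-> /eqP bv] ->; rewrite /beta bu bv.
      by exists (b v); rewrite !inE lu lv tuv buv !eqxx.
    rewrite -[val (b v)]/(beta v) -[b v < b u]/(beta v < beta u).
    case: (leaf _ _ u); case: (leaf _ _ v); case: (t u v); case: (beta u == beta v);
      by rewrite /= ?andbF ?andbT ?orbF ?orbT.
move=> [k [X [beta [t [[k0 XK bk bleaf [tirr ttot ttr]] DE]]]]].
pose x (i : 'I_k) := X i; pose b u := Ordinal (bk u).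
have leafE u : leaf X beta u = (u \notin codom x).
  rewrite /leaf; congr (~~ _); apply/eqP/codomP => [E|[i ->]].
    by exists (b u).
  by rewrite /x XK.
have xK : cancel x b by move=> i; apply: val_inj; rewrite /= XK.
have tree u v : star (caterpillar_tree x b) u v =
    [&& ~~ leaf X beta u, ~~ leaf X beta v
      & (beta v == (beta u).+1) || (beta u == (beta v).+1)]
    || (beta u == beta v) && ((leaf X beta u && ~~ leaf X beta v)
         || (~~ leaf X beta u && leaf X beta v)).
  have onb u' v' : (u' \notin codom x) && (v' == x (b u')) =
     [&& leaf X beta u', ~~ leaf X beta v' & beta u' == beta v'].
    rewrite -leafE; congr (_ && _); rewrite /leaf negbK /x /=.
    apply/eqP/andP => [->|[/eqP E /eqP bE]]; first by rewrite XK ?eqxx.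
    by rewrite E bE.
  rewrite /star /caterpillar_tree !onb -(negbK (u \in _)) -(negbK (v \in _)) -!leafE /=.
  case: (leaf _ _ u); case: (leaf _ _ v) => //=;
    by rewrite ?andbF ?andbT ?orbF // eq_sym.
exists k, x, b, t; split=> //.
- by move=> u; rewrite -leafE; apply: bleaf.
- have inb u j : (u \in blossom_leaves x b j) -> leaf X beta u /\ beta u = j.
    by rewrite inE -leafE => /andP[-> /eqP<-].
  move=> j; split.
  + by move=> u /inb[lu _]; apply: tirr.
  + by move=> u v /inb[lu bu] /inb[lv bv]; apply: ttot => //; rewrite bu bv.
  + by move=> v u z /inb[lv bv] /inb[lu bu] /inb[lz bz]; apply: ttr => //; rewrite ?bu ?bv ?bz.
- move=> u v; rewrite DE /extended_caterpillar_arc tree /caterpillar_arc.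
  have -> : [exists j, [&& u \in blossom_leaves x b j, v \in blossom_leaves x b j & t u v]]
     = [&& beta u == beta v, leaf X beta u, leaf X beta v & t u v].
    rewrite !leafE; apply/existsP/and4P => [[j /and3P[]]|[/eqP buv lu lv tuv]].
      by rewrite !inE => /andP[-> /eqP bu] /andP[-> /eqP bv] ->; rewrite -[beta u]/(val (b u)) bu -bv.
    by exists (b v); rewrite !inE lu lv tuv -val_eqE /= buv !eqxx.
  rewrite /=; case: (leaf _ _ u); case: (leaf _ _ v); case: (t u v); case: (beta u == beta v);
    by rewrite /= ?andbF ?andbT ?orbF ?orbT.
Qed.

(** With two backbone vertices there are no leaves, and the backbone can be reversed. *)
Lemma caterpillar_swap (V : finType) (X : nat -> V) beta (t : rel V) :
  caterpillar_data 2 X beta t ->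
  caterpillar_data 2 (fun j => X (1 - j)) (fun u => 1 - beta u) t /\
  caterpillar_arc X beta t =2
    caterpillar_arc (fun j => X (1 - j)) (fun u => 1 - beta u) t.
Proof.
case=> k0 XK bk bleaf _.
have noleaf u : ~~ leaf X beta u by apply/negP => /bleaf; lia.
have b1 u : 1 - (1 - beta u) = beta u by have := bk u; lia.
have noleaf' u : ~~ leaf (fun j => X (1 - j)) (fun u => 1 - beta u) u.
  by rewrite /leaf b1; exact: noleaf.
have nl u : leaf X beta u = false := negbTE (noleaf u).
have nl' u : leaf (fun j => X (1 - j)) (fun u => 1 - beta u) u = false := negbTE (noleaf' u).
split.
  split; first by [].
  - by move=> j j2; rewrite XK; lia.
  - by move=> u; lia.
  - by move=> u; rewrite nl'.
  - by split=> [u|u v|u v z]; rewrite nl'.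
move=> u v; rewrite /caterpillar_arc !nl !nl' /=.
by have := bk u; have := bk v; case: (beta u) => [|[|]] //; case: (beta v) => [|[|]].
Qed.

Section Extend.
Variables (V : finType) (D : rel V) (y p : V).
Hypotheses (D_irr : irreflexive D).
Hypothesis (outy : forall u, D y u = (u == p)).
Hypothesis (to_y : forall v, v != y -> D v y).
Hypothesis (to_p : forall v, v != y -> v != p -> D v p).

Local Notation W := {x | x \in [set~ y]}.

Definition extend_fun (A : Type) (f : W -> A) (d : A) (v : V) : A := oapp f d (insub v).

Lemma extend_val A (f : W -> A) d w : extend_fun f d (val w) = f w.
Proof. by rewrite /extend_fun valK. Qed.

Lemma extend_y A (f : W -> A) d : extend_fun f d y = d.
Proof. by rewrite /extend_fun insubN // !inE eqxx. Qed.

Lemma delete_cases v : v = y \/ exists w : W, v = val w.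
Proof.
have [->|vy] := eqVneq v y; [by left|right].
have vW : v \in [set~ y] by rewrite !inE.
by exists (exist _ v vW).
Qed.

Lemma val_neq_y (w : W) : (val w == y) = false.
Proof. by apply/negbTE; have := valP w; rewrite !inE. Qed.

(** Here the backbone is prolonged by [y], and all indices are shifted. *)
Lemma extend_backbone k X beta t : caterpillar_data k X beta t ->
  delete D y =2 caterpillar_arc X beta t -> p = val (X 0) -> extended_caterpillar D.
Proof.
move=> [k0 XK bk bleaf [tirr ttot ttr]] DE pE; apply/extended_caterpillarP.
pose X' j := if j is j'.+1 then val (X j') else y.
pose beta' := extend_fun (fun w => (beta w).+1) 0.
pose t' := fun u v => extend_fun (fun w => extend_fun (fun w' => t w w') false v) false u.
have leafW w : leaf X' beta' (val w) = leaf X beta w.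
  by rewrite /leaf /beta' extend_val /= val_eqE.
have leafy : leaf X' beta' y = false by rewrite /leaf /beta' extend_y /= eqxx.
have t'E w w' : t' (val w) (val w') = t w w' by rewrite /t' !extend_val.
have b'E w : beta' (val w) = (beta w).+1 by rewrite /beta' extend_val.
have b'y : beta' y = 0 by rewrite /beta' extend_y.
exists k.+1, X', beta', t'; split.
  split=> //.
  - by case=> [|j] jk //=; rewrite b'E XK.
  - by move=> u; case: (delete_cases u) => [->|[w ->]]; rewrite ?b'y ?b'E // ltnS.
  - move=> u; case: (delete_cases u) => [->|[w ->]]; rewrite ?leafy ?leafW // b'E.
    by move/bleaf=> [].
  split.
  - move=> u; case: (delete_cases u) => [->|[w ->]]; rewrite ?leafy ?leafW // t'E.
    exact: tirr.
  - move=> u v; case: (delete_cases u) => [->|[w ->]]; rewrite ?leafy ?leafW //.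
    case: (delete_cases v) => [->|[w' ->]]; rewrite ?leafy ?leafW // !t'E !b'E val_eqE.
    by move=> lu lv [buv]; apply: ttot.
  - move=> u v z; case: (delete_cases u) => [->|[w ->]]; rewrite ?leafy ?leafW //.
    case: (delete_cases v) => [->|[w' ->]]; rewrite ?leafy ?leafW //.
    case: (delete_cases z) => [->|[w'' ->]]; rewrite ?leafy ?leafW // !t'E !b'E.
    by move=> lu lv lz [buv] [bzv]; apply: ttr.
move=> u v; rewrite /caterpillar_arc.
case: (delete_cases u) => [->|[w ->]]; case: (delete_cases v) => [->|[w' ->]];
  rewrite ?leafy ?leafW ?b'y ?b'E ?t'E /= ?andbF ?orbF.
- by rewrite D_irr.
- rewrite outy pE val_eqE eqSS; apply/eqP/andP => [->|[lw /eqP bw]].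
    split; last by rewrite XK.
    by apply/negP => /bleaf[]; rewrite XK.
  by apply/eqP; move: lw; rewrite /leaf negbK bw.
- by rewrite to_y ?val_neq_y //= !orbT.
- by rewrite -[D _ _]/(delete D y w w') DE /caterpillar_arc !eqSS ltnS.
Qed.

(** Here [y] replaces the low end [X 0] of the backbone, and [X 0] becomes the last leaf
    of the blossom of [p]: its only out-neighbour is [p]. A backbone of length at
    least 3 is needed for [p] to be an interior vertex. *)
Lemma extend_blossom k X beta t : caterpillar_data k X beta t ->
  delete D y =2 caterpillar_arc X beta t -> 2 < k -> p = val (X 1) ->
  extended_caterpillar D.
Proof.
move=> [k0 XK bk bleaf [tirr ttot ttr]] DE k2 pE; apply/extended_caterpillarP.
pose X' j := if j == 0 then y else val (X j).
pose beta' := extend_fun (fun w => maxn 1 (beta w)) 0.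
pose tW w w' := (w' == X 0) && (w != X 0) || [&& w' != X 0, w != X 0 & t w w'].
pose t' := fun u v => extend_fun (fun w => extend_fun (fun w' => tW w w') false v) false u.
have t'E w w' : t' (val w) (val w') = tW w w' by rewrite /t' !extend_val.
have b'E w : beta' (val w) = maxn 1 (beta w) by rewrite /beta' extend_val.
have b'y : beta' y = 0 by rewrite /beta' extend_y.
have bX0 : beta (X 0) = 0 by rewrite XK.
have b0 w : (beta w == 0) = (w == X 0).
  apply/eqP/eqP => [bw|->//]; apply/eqP; apply: contraT => nw.
  by have /bleaf[] : leaf X beta w; [rewrite /leaf bw|rewrite bw].
have maxE w : w != X 0 -> maxn 1 (beta w) = beta w.
  by rewrite -b0 -lt0n => /maxn_idPr.
have leafW w : leaf X' beta' (val w) = (w == X 0) || leaf X beta w.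
  rewrite /leaf b'E /X'; have [->|w0] := eqVneq w (X 0).
    rewrite bX0 /= val_eqE; apply/eqP => E; have := XK 1 (ltnW k2).
    by rewrite -E bX0.
  by rewrite maxE //= b0 ?(negbTE w0) val_eqE.
have leafy : leaf X' beta' y = false by rewrite /leaf b'y /= eqxx.
exists k, X', beta', t'; split.
  split=> //.
  - move=> j jk; rewrite /X'; case: eqP => [->|/eqP j0]; first by rewrite b'y.
    by rewrite b'E XK //; apply/maxn_idPr; rewrite lt0n.
  - move=> u; case: (delete_cases u) => [->|[w ->]]; rewrite ?b'y ?b'E //.
    by rewrite gtn_max bk andbT (ltnW k2).
  - move=> u; case: (delete_cases u) => [->|[w ->]]; rewrite ?leafy ?leafW // b'E.
    have [->|w0 /= /bleaf] := eqVneq w (X 0); first by rewrite bX0.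
    by rewrite maxE.
  split.
  - move=> u; case: (delete_cases u) => [->|[w ->]]; rewrite ?leafy ?leafW // t'E /tW.
    by have [//|w0 /= /tirr] := eqVneq w (X 0).
  - move=> u v; case: (delete_cases u) => [->|[w ->]]; rewrite ?leafy ?leafW //.
    case: (delete_cases v) => [->|[w' ->]]; rewrite ?leafy ?leafW // !t'E !b'E val_eqE /tW.
    have [->|w0] := eqVneq w (X 0).
      by have [->|w0'] := eqVneq w' (X 0); rewrite ?eqxx //= ?(negbTE w0').
    have [->|w0'] /= := eqVneq w' (X 0); first by rewrite ?(negbTE w0).
    by rewrite !maxE // ?(negbTE w0) ?(negbTE w0') /=; apply: ttot.
  - move=> u v z; case: (delete_cases u) => [->|[w ->]]; rewrite ?leafy ?leafW //.
    case: (delete_cases v) => [->|[w' ->]]; rewrite ?leafy ?leafW //.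
    case: (delete_cases z) => [->|[w'' ->]]; rewrite ?leafy ?leafW // !t'E !b'E /tW.
    have [->|w0] /= := eqVneq w (X 0); first by rewrite !andbF.
    have [->|w0'] /= := eqVneq w' (X 0); first by rewrite ?eqxx /= ?andbF.
    have [->|w0''] //= := eqVneq w'' (X 0).
    rewrite !maxE //; exact: ttr.
move=> u v; rewrite /caterpillar_arc.
case: (delete_cases u) => [->|[w ->]]; case: (delete_cases v) => [->|[w' ->]];
  rewrite ?leafy ?leafW ?b'y ?b'E ?t'E /= ?andbF ?orbF.
- by rewrite D_irr.
- rewrite outy pE val_eqE; have [->|w0] /= := eqVneq w' (X 0).
    rewrite bX0 /=; apply/negbTE/eqP => E.
    by have := XK 1 (ltnW k2); rewrite -E bX0.
  rewrite maxE //; apply/eqP/idP => [->|].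
    by rewrite XK ?(ltnW k2) // /leaf XK ?(ltnW k2) // eqxx.
  case/orP=> [/andP[lw /eqP bw]|/andP[/eqP bw _]].
    by move: lw; rewrite /leaf negbK bw => /eqP.
  by have := b0 w'; rewrite -bw eqxx (negbTE w0).
- by rewrite to_y ?val_neq_y //= leq_max /= !orbT.
rewrite -[D _ _]/(delete D y w w') DE /caterpillar_arc /tW.
have lX0 : leaf X beta (X 0) = false by rewrite /leaf bX0 eqxx.
have [->|w0] /= := eqVneq w (X 0); have [->|w0'] //= := eqVneq w' (X 0).
- by rewrite ?lX0 ?bX0.
- rewrite lX0 bX0 (maxE _ w0') /=; have := b0 w'; rewrite (negbTE w0').
  by case: (leaf X beta w') => /= ?; apply/idP/idP; lia.
- rewrite lX0 bX0 (maxE _ w0) /=; have := b0 w; rewrite (negbTE w0).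
  by case: (leaf X beta w) => /= ?; apply/idP/idP; lia.
- by rewrite !maxE.
Qed.

(** The only vertices that are out-neighbours of all others are the two lowest
    backbone vertices. *)
Theorem caterpillar_extend : extended_caterpillar (delete D y) -> extended_caterpillar D.
Proof.
case/extended_caterpillarP=> k [X [beta [t [data DE]]]].
have [k0 XK bk bleaf _] := data.
have py : p != y.
  by apply/eqP => py; have := D_irr y; rewrite outy py eqxx.
have [p' pE] : exists p' : W, p = val p'.
  by case: (delete_cases p) => [E|//]; rewrite E eqxx in py.
have [p0|p0] := eqVneq p' (X 0); first by apply: extend_backbone data DE _; rewrite pE p0.
have bX0 : beta (X 0) = 0 by rewrite XK.
have lX0 : leaf X beta (X 0) = false by rewrite /leaf bX0 eqxx.
have: delete D y (X 0) p' by rewrite /delete -pE to_p ?val_neq_y // pE val_eqE eq_sym.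
rewrite DE /caterpillar_arc lX0 bX0 /=.
case/or3P=> [/andP[lp bp]|/andP[/eqP bp lp]|]; last by rewrite ltn0.
  2: by move: lp; rewrite orbF => /bleaf[]; rewrite -bp.
have {}bp : beta p' = 1 by lia.
move: lp; rewrite /leaf negbK bp => /eqP p1.
have [k2|k2] := ltnP 2 k; first by apply: extend_blossom data DE k2 _; rewrite pE p1.
have {}k2 : k = 2 by have := bk p'; rewrite bp; lia.
subst k; have [data' DE'] := caterpillar_swap data.
apply: (extend_backbone data'); first by move=> u v; rewrite DE DE'.
by rewrite pE p1.
Qed.

End Extend.

(** Take for [y] the low end of the backbone. After its deletion the next blossom
    provides the new low end, namely its last leaf if it has one and its backbone
    vertex otherwise. *)
Theorem caterpillar_restrict (V : finType) (D : rel V) : extended_caterpillar D ->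
  (forall u v : V, u = v) \/
  exists y p, [/\ p != y, forall u, D y u = (u == p), forall v, v != y -> D v y,
    forall v, v != y -> v != p -> D v p & extended_caterpillar (delete D y)].
Proof.
case/extended_caterpillarP=> k [X [beta [t [[k0 XK bk bleaf [tirr ttot ttr]] DE]]]].
have [k1|k1] := leqP k 1.
  left; have X0 u : u = X 0.
    have bu : beta u = 0 by have := bk u; lia.
    apply/eqP; apply: contraT => nu.
    by have /bleaf[] : leaf X beta u; [rewrite /leaf bu|rewrite bu].
  by move=> u v; rewrite (X0 u) (X0 v).
right; have bX0 : beta (X 0) = 0 by rewrite XK.
have bX1 : beta (X 1) = 1 by rewrite XK.
have lX0 : leaf X beta (X 0) = false by rewrite /leaf bX0 eqxx.
have lX1 : leaf X beta (X 1) = false by rewrite /leaf bX1 eqxx.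
have b0 w : (beta w == 0) = (w == X 0).
  apply/eqP/eqP => [bw|->//]; apply/eqP; apply: contraT => nw.
  by have /bleaf[] : leaf X beta w; [rewrite /leaf bw|rewrite bw].
have X10 : X 1 != X 0 by rewrite -b0 bX1.
exists (X 0), (X 1); split=> //.
- move=> u; rewrite DE /caterpillar_arc lX0 bX0 /= ltn0 !orbF.
  apply/idP/eqP => [/orP[/andP[lu /eqP bu]|/andP[/eqP bu lu]]|->].
  + by move: lu; rewrite /leaf negbK bu => /eqP.
  + by have /bleaf[] := lu; rewrite -bu.
  + by rewrite lX1 bX1.
- by move=> v v0; rewrite DE /caterpillar_arc bX0 lt0n b0 v0 !orbT.
- move=> v v0 v1; rewrite DE /caterpillar_arc bX1 lX1 /= andbT !andbF !orbF.
  have bv0 : 0 < beta v by rewrite lt0n b0.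
  have [bv|bv] := eqVneq (beta v) 1; last first.
    have bv2 : 1 < beta v by rewrite ltn_neqAle eq_sym bv.
    by rewrite bv2 ?orbT.
  by rewrite /leaf bv v1 ?orbT.
have inW v : v != X 0 -> v \in [set~ X 0] by rewrite !inE.
pose W := {x | x \in [set~ X 0]}; pose w1 : W := exist _ (X 1) (inW _ X10).
have W0 (w : W) : val w != X 0 by have := valP w; rewrite !inE.
have bW (w : W) : 0 < beta (val w) by rewrite lt0n b0.
pose Y j : W := insubd w1 (X j).
have valY j : 0 < j -> j < k -> val (Y j) = X j.
  by move=> j0 jk; rewrite insubdK //; apply: (inW (X j)); rewrite -b0 XK // -lt0n.
pose t' (u v : W) := t (val u) (val v).
apply/extended_caterpillarP.
pose S := [set u | leaf X beta u && (beta u == 1)].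
have [S0|[x xS]] := set_0Vmem S.
  pose X' j := Y j.+1; pose beta' (w : W) := (beta (val w)).-1.
  have b'E (w : W) : (beta' w).+1 = beta (val w) by rewrite /beta' prednK.
  have leafW (w : W) : leaf X' beta' w = leaf X beta (val w).
    by rewrite /leaf /X' b'E -val_eqE valY.
  have b2 (w : W) : leaf X beta (val w) -> 1 < beta (val w).
    move=> lw; have /negP := in_set0 (val w); rewrite -S0 inE lw /=.
    by have := bW w; case: (beta _) => [|[|]].
  exists k.-1, X', beta', t'; split.
    split.
    - by lia.
    - by move=> j jk; rewrite /beta' valY ?XK //; lia.
    - by move=> w; rewrite -ltnS b'E prednK // bk.
    - move=> w; rewrite leafW => lw; have [_ bk'] := bleaf _ lw.
      by split; [rewrite -ltnS b'E b2|rewrite b'E -ltnS prednK].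
    split.
    - by move=> u; rewrite leafW; apply: tirr.
    - move=> u v; rewrite !leafW => lu lv buv uv; apply: ttot => //.
      by rewrite -!b'E buv.
    - move=> u v z; rewrite !leafW => lu lv lz buv bzv; apply: ttr => //.
        by rewrite -!b'E buv.
      by rewrite -!b'E bzv.
  by move=> u v; rewrite /delete DE /caterpillar_arc !leafW -!b'E !eqSS ltnS.
have [l lS lmax] : exists2 l, l \in S & forall u, u \in S -> u != l -> t u l.
  case: (arg_minnP (fun z => #|[set v in S | t z v]|) xS) => l lS' lmin.
  have lS : l \in S by [].
  exists l => // u uS ul; have [lu /eqP bu] : leaf X beta u /\ beta u == 1.
    by move: uS; rewrite inE => /andP[].
  have [ll /eqP bl] : leaf X beta l /\ beta l == 1 by move: lS; rewrite inE => /andP[].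
  have := ttot u l lu ll; rewrite bu bl => /(_ erefl ul).
  case tul: (t u l) => //= tlu; have := lmin u uS; rewrite leqNgt => /negP[].
  apply/proper_card/properP; split; last first.
    by exists u; rewrite !inE lu bu eqxx //= ?tlu // (negbTE (tirr u lu)).
  apply/subsetP => v; rewrite !inE => /andP[/andP[lv /eqP bv] tuv].
  by rewrite lv bv eqxx; apply: (ttr l u v) => //; rewrite ?bu ?bl ?bv.
have [ll /eqP bl] : leaf X beta l /\ beta l == 1 by move: lS; rewrite inE => /andP[].
have l0 : l != X 0 by rewrite -b0 bl.
pose l' : W := exist _ l (inW l l0).
have l1 : l != X 1 by move: ll; rewrite /leaf bl.
have [_ k2] := bleaf l ll; rewrite bl in k2.
pose X' j := if j == 0 then l' else Y j.
pose beta' (w : W) := if w == l' then 0 else beta (val w).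
have b'l : beta' l' = 0 by rewrite /beta' eqxx.
have b'E (w : W) : w != l' -> beta' w = beta (val w) by rewrite /beta' => /negbTE->.
have leafW (w : W) : w != l' -> leaf X' beta' w = leaf X beta (val w).
  by move=> wl; rewrite /leaf b'E // /X' b0 (negbTE (W0 w)) -val_eqE valY.
have leafl : leaf X' beta' l' = false by rewrite /leaf b'l eqxx.
have Yl j : 0 < j -> j < k -> Y j != l'.
  move=> j0 jk; rewrite -val_eqE valY //=; apply/eqP => E.
  by move: ll; rewrite /leaf -E XK // eqxx.
exists k, X', beta', t'; split.
  split=> //.
  - move=> j jk; rewrite /X'; case: posnP => [->//|j0].
    by rewrite b'E ?Yl // valY // XK.
  - by move=> w; rewrite /beta'; case: ifP.
  - move=> w; have [->|wl] := eqVneq w l'; first by rewrite leafl.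
    by rewrite leafW // b'E //; apply: bleaf.
  split.
  - move=> u; have [->|ul] := eqVneq u l'; first by rewrite leafl.
    by rewrite leafW //; apply: tirr.
  - move=> u v; have [->|ul] := eqVneq u l'; first by rewrite leafl.
    have [->|vl] := eqVneq v l'; first by rewrite leafl.
    by rewrite !leafW // !b'E // => lu lv buv uv; apply: ttot.
  - move=> u v z; have [->|ul] := eqVneq u l'; first by rewrite leafl.
    have [->|vl] := eqVneq v l'; first by rewrite leafl.
    have [->|zl] := eqVneq z l'; first by rewrite leafl.
    by rewrite !leafW // !b'E //; apply: ttr.
move=> u v; rewrite /delete DE /caterpillar_arc.
have lE (w : W) : w != l' -> (val w != l) by rewrite -val_eqE.
have [->|ul] := eqVneq u l'; have [->|vl] := eqVneq v l'.
- by rewrite leafl b'l /= ll bl (negbTE (tirr l ll)).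
- rewrite leafl b'l leafW // b'E // ll bl [1 == _]eq_sym.
  have := bW v; case: (boolP (leaf X beta (val v))) => lv /=; last first.
    by case: (beta (val v)) => [|[|n]].
  case: (eqVneq (beta (val v)) 1) => [bv1|] /=; last first.
    by case: (beta (val v)) => [|[|n]].
  have vS : val v \in S by rewrite inE lv bv1 eqxx.
  have vl' : val v != l := lE v vl.
  have := ttot (val v) l lv ll (etrans bv1 (esym bl)) vl'.
  by rewrite (lmax _ vS vl') /= => /negbTE tlv; rewrite tlv bv1.
- rewrite leafl b'l leafW // b'E // ll bl /=.
  have bu := bW u; rewrite bu !orbT; apply/idP.
  case: (eqVneq (beta (val u)) 1) => [bu1|bu1] /=; last first.
    by move: bu bu1; case: (beta (val u)) => [|[|n]] //=; rewrite !orbT.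
  case: (boolP (leaf X beta (val u))) => lu //=.
  have uS : val u \in S by rewrite inE lu bu1 eqxx.
  by rewrite (lmax _ uS (lE u ul)).
- by rewrite !leafW // !b'E.
Qed.

Import Order.TTheory GRing.Theory Num.Theory.

(** * Pairs of matrices with a given digraph *)
Section Realization.
Local Open Scope ring_scope.
Variable R : realType.

(** What is needed of a symplectic pair, for matrices indexed by the vertices. Signs
    enter only through the products of corresponding entries, and the equation is
    written with rows, as [a b^T = 1]. *)
Definition biorthogonal (V : finType) (D : rel V) (a b : V -> V -> R) :=
  (forall u v, if (u == v) || D u v then 0 < a u v * b u v
               else (a u v == 0) && (b u v == 0)) /\
  (forall u v, \sum_x a u x * b v x = (u == v)%:R).

Lemma biorthogonal_of_allows (V : finType) (D : rel V) :
  irreflexive D -> allows_symplectic_pairs R D -> exists a b, biorthogonal D a b.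
Proof.
move=> irr [H [Hs Hd [f bf fD] [A [B [QA QB AB]]]]].
exists (fun u v => A (f u) (f v)), (fun u v => B (f u) (f v)); split.
  move=> u v; have AE : (A (f u) (f v) != 0) = (u == v) || D u v.
    rewrite -sgz_eq0 QA; have [->|uv] := eqVneq u v; first by rewrite Hd.
    by rewrite sgz_eq0 -fD /pattern_digraph (inj_eq (bij_inj bf)) uv.
  have sAB : sgz (A (f u) (f v)) = sgz (B (f u) (f v)) by rewrite QA QB.
  rewrite -AE; case: eqP => [A0|/eqP A0] /=.
    have := congr1 (fun s => s == 0) sAB.
    by rewrite A0 sgz0 eqxx sgz_eq0 => <-.
  case: (ltrgt0P (A (f u) (f v))) A0 sAB => // A1 _.
    by rewrite (gtr0_sgz A1) => /esym/eqP; rewrite sgz_cp0 => B1; rewrite mulr_gt0.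
  by rewrite (ltr0_sgz A1) => /esym/eqP; rewrite sgz_cp0 => B1; rewrite nmulr_rgt0.
move=> u v; have BA : B *m A^T = 1%:M by apply: mulmx1C.
have := congr1 (fun M : 'M_ _ => M (f v) (f u)) BA.
rewrite !mxE (inj_eq (bij_inj bf)) eq_sym => <-.
rewrite (reindex f) /=; last by apply: onW_bij.
by apply: eq_bigr => x _; rewrite !mxE mulrC.
Qed.

Lemma allows_of_matrices (V : finType) (D : rel V) (a b : V -> V -> R) :
  irreflexive D -> (forall u, a u u < 0) ->
  (forall u v, (a u v != 0) = (u == v) || D u v) ->
  (forall u v, sgz (a u v) = sgz (b u v)) ->
  (forall u v, \sum_x a u x * b v x = (u == v)%:R) -> allows_symplectic_pairs R D.
Proof.
move=> irr neg supp sg orth.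
exists (\matrix_(i, j) sgz (a (enum_val i) (enum_val j))); split.
- by move=> i j; rewrite mxE !inE; case: sgzP.
- by move=> i; rewrite mxE; apply: ltr0_sgz.
- exists enum_rank; first exact: enum_rank_bij.
  move=> u v; rewrite /pattern_digraph mxE !enum_rankK sgz_eq0 supp.
  rewrite (inj_eq enum_rank_inj); have [->|uv] := eqVneq u v; first by rewrite irr.
  by [].
exists (\matrix_(i, j) a (enum_val i) (enum_val j)).
exists (\matrix_(i, j) b (enum_val i) (enum_val j)); split.
- by move=> i j; rewrite !mxE sgz_id.
- by move=> i j; rewrite !mxE sg sgz_id.
rewrite -[LHS]trmxK trmx_mul trmxK; apply: (canLR (@trmxK _ _ _)); rewrite trmx1.
apply: mulmx1C; apply/matrixP => i j; rewrite !mxE.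
rewrite (reindex enum_rank) /=; last by apply: onW_bij; exact: enum_rank_bij.
under eq_bigr do rewrite !mxE enum_rankK.
by rewrite orth (inj_eq enum_val_inj).
Qed.

(** The rows of [a] and [b] other than [y] are orthogonal to row [y], hence
    proportional to a fixed vector on the columns [y] and [p]; these columns can
    thus be merged, as by the inverse of a Givens rotation. *)
Lemma biorthogonal_delete (V : finType) (D : rel V) (a b : V -> V -> R) y p :
  irreflexive D -> (forall u, D y u = (u == p)) -> biorthogonal D a b ->
  (forall v, v != y -> D v y = (v == p) || D v p) /\
  exists a' b', biorthogonal (delete D y) a' b'.
Proof.
move=> irr outy [supp orth].
have yp : p != y by apply/eqP => py; have := irr y; rewrite outy py eqxx.
(* Columns [y] and [p] of each row but row [y] are proportional; the factors for [a] and
   [b] have a positive product, which the factor [k] below takes into account. *)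
have pos u v : (u == v) || D u v -> 0 < a u v * b u v by have := supp u v; case: ifP.
have zero u v : ~~ ((u == v) || D u v) -> a u v = 0 /\ b u v = 0.
  by have := supp u v; case: ifP => // _ /andP[/eqP-> /eqP->].
have suppb u v : (b u v != 0) = (u == v) || D u v.
  have [uv|/zero[_ ->]] := boolP ((u == v) || D u v); last by rewrite eqxx.
  by have := pos u v uv; apply: contraTneq => ->; rewrite mulr0 ltxx.
have yy0 : 0 < a y y * b y y by apply: pos; rewrite eqxx.
have yp0 : 0 < a y p * b y p by apply: pos; rewrite outy eqxx orbT.
have ayy : a y y != 0 by apply: contraTneq yy0 => ->; rewrite mul0r ltxx.
have byy : b y y != 0 by apply: contraTneq yy0 => ->; rewrite mulr0 ltxx.
have ayp : a y p != 0 by apply: contraTneq yp0 => ->; rewrite mul0r ltxx.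
have sum2 (F : V -> R) : (forall x, x != y -> x != p -> F x = 0) ->
    \sum_x F x = F y + F p.
  move=> F0; rewrite (bigD1 y) //= (bigD1 p) //= big1 ?addr0 // => x /andP[].
  exact: F0.
have row0 x : x != y -> x != p -> a y x = 0 /\ b y x = 0.
  by move=> xy xp; apply: zero; rewrite negb_or eq_sym xy outy.
have bE v : v != y -> b v y = - (a y p * b v p / a y y).
  move=> vy; have := orth y v; rewrite sum2; last by move=> x xy xp; rewrite (row0 x xy xp).1 mul0r.
  rewrite eq_sym (negbTE vy) /= => E; apply: (mulfI ayy); move: E.
  by move/eqP; rewrite addr_eq0 => /eqP->; field.
have aE v : v != y -> a v y = - (a v p * b y p / b y y).
  move=> vy; have := orth v y; rewrite sum2; last by move=> x xy xp; rewrite (row0 x xy xp).2 mulr0.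
  rewrite (negbTE vy) /= => E; apply: (mulIf byy); move: E.
  by move/eqP; rewrite addr_eq0 => /eqP->; field.
split=> [v vy|].
  have := suppb v y; rewrite (negbTE vy) /= => <-; rewrite -suppb bE //.
  by rewrite oppr_eq0 !mulf_eq0 invr_eq0 !negb_or ayp ayy andbT.
pose k := 1 + (a y p * b y p) / (a y y * b y y).
have k0 : 0 < k by rewrite addr_gt0 // divr_gt0.
exists (fun u v => (if val v == p then k else 1) * a (val u) (val v)).
exists (fun u v => b (val u) (val v)); split=> u v.
  have := supp (val u) (val v); rewrite /delete val_eqE; case: ifP => _.
    by case: ifP => _; rewrite ?mul1r // -mulrA => ?; rewrite mulr_gt0.
  by case/andP=> /eqP-> ->; rewrite mulr0 eqxx.
have [uy vy] : val u != y /\ val v != y.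
  by split; [have := valP u|have := valP v]; rewrite !inE.
rewrite -val_eqE -(orth (val u) (val v)) (bigD1 y) //=.
pose F x := (if x == p then k else 1) * a (val u) x * b (val v) x.
rewrite -(big_sub [in [set~ y]] F) /F.
have pin : p \in [set~ y] by rewrite !inE.
rewrite (bigD1 p) //= eqxx [in RHS](bigD1 p) //= addrA; congr (_ + _).
  by rewrite bE // aE // /k; field; rewrite ayy byy.
by apply: eq_big => [x|x /andP[_ /negbTE->]]; rewrite ?inE ?mul1r.
Qed.

End Realization.

Section Givens.
Local Open Scope ring_scope.
Variable R : realType.

Definition orthogonal_realization (V : finType) (D : rel V) (a : V -> V -> R) :=
  [/\ forall u, 0 < a u u, forall u v, (a u v != 0) = (u == v) || D u v
    & forall u v, \sum_x a u x * a v x = (u == v)%:R].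

(** Multiply the given matrix, bordered by a 1 at [y], by a rotation in the plane of
    [y] and [p]; column [y] becomes a multiple of the old column [p], which has no zero
    entry. Any angle in the first quadrant will do, such as the one with cosine 4/5
    and sine 3/5. *)
Lemma givens_extend (V : finType) (D : rel V) (y p : V) :
  p != y -> (forall u, D y u = (u == p)) -> (forall v, v != y -> D v y) ->
  (forall v, v != y -> v != p -> D v p) ->
  (exists a, orthogonal_realization (delete D y) a) ->
  exists a, orthogonal_realization D a.
Proof.
move=> py outy to_y to_p [a [apos asupp aorth]].
have pW : p \in [set~ y] by rewrite !inE.
pose W : finType := {x | x \in [set~ y]}; pose p' : W := exist _ p pW.
pose c (w : W) : R := if w == p' then 4 / 5 else 1.
pose s (w : W) : R := if w == p' then - (3 / 5) else 0.
pose b u v := extend_fun (fun u' : W => extend_fun (fun v' : W => c v' * a u' v')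
   (3 / 5 * a u' p') v) (extend_fun s (4 / 5) v) u.
have byy : b y y = 4 / 5 by rewrite /b !extend_y.
have byw w : b y (val w) = s w by rewrite /b extend_y extend_val.
have bwy w : b (val w) y = 3 / 5 * a w p' by rewrite /b extend_val extend_y.
have bww w w' : b (val w) (val w') = c w' * a w w' by rewrite /b !extend_val.
have c0 w : c w != 0 by rewrite /c; case: ifP => _; rewrite ?oner_eq0 //; lra.
have sumV (F : V -> R) : \sum_x F x = F y + (F p + \sum_(w | w != p') F (val w)).
  rewrite (bigD1 y) //=; congr (_ + _).
  transitivity (\sum_(w : W) F (val w)); last by rewrite (bigD1 p').
  rewrite -(big_sub [in [set~ y]] F).
  by apply: eq_bigl => x; rewrite !inE.
have sumW u v : \sum_(w | w != p') b (val u) (val w) * b (val v) (val w) =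
    (u == v)%:R - a u p' * a v p'.
  rewrite -aorth [in RHS](bigD1 p') //= [RHS]addrC addKr; apply: eq_bigr => w wp.
  by rewrite !bww /c (negbTE wp) !mul1r.
have neqy (w : W) : val w != y by have := valP w; rewrite !inE.
have bp : b y p = - (3 / 5) by rewrite (byw p') /s eqxx.
have bwp w : b (val w) p = 4 / 5 * a w p' by rewrite (bww w p') /c eqxx.
exists b; split.
- move=> u; case: (delete_cases y u) => [->|[w ->]]; first by rewrite byy; lra.
  rewrite bww mulr_gt0 // /c; case: ifP => _; lra.
- move=> u v; case: (delete_cases y u) => [->|[w ->]]; case: (delete_cases y v) => [->|[w' ->]].
  + by rewrite byy eqxx; lra.
  + rewrite byw outy [y == _]eq_sym (negbTE (neqy w')) /= /s -val_eqE /=.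
    by case: ifP => _; rewrite ?eqxx //; lra.
  + rewrite bwy to_y // orbT mulf_eq0 negb_or asupp.
    apply/andP; split; first by lra.
    by case: (eqVneq w p') => //= wp; apply: to_p.
  + by rewrite bww mulf_eq0 negb_or c0 asupp val_eqE.
move=> u v; case: (delete_cases y u) => [->|[w ->]]; case: (delete_cases y v) => [->|[w' ->]].
- rewrite sumV eqxx byy bp big1 => [|w wp]; first by rewrite mulr1n; field.
  by rewrite byw /s (negbTE wp) mul0r.
- rewrite sumV [y == _]eq_sym (negbTE (neqy w')) byy bp bwy bwp big1 => [|w wp]; first by rewrite mulr0n; field.
  by rewrite byw /s (negbTE wp) mul0r.
- rewrite sumV (negbTE (neqy w)) byy bp bwy bwp big1 => [|w' wp]; first by rewrite mulr0n; field.
  by rewrite byw /s (negbTE wp) mulr0.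
- by rewrite sumV !bwy !bwp sumW val_eqE; field.
Qed.

Lemma caterpillar_orthogonal (V : finType) (D : rel V) :
  extended_caterpillar D -> exists a, orthogonal_realization D a.
Proof.
have [n] := ubnP #|V|; elim: n V D => // n IH V D; rewrite ltnS => cV ecD.
case: (caterpillar_restrict ecD) => [all1|[y [p [py outy to_y to_p ec']]]].
  exists (fun _ _ => 1); split=> [u|u v|u v]; first exact: ltr01.
    by rewrite oner_eq0 (all1 u v) eqxx.
  rewrite (bigD1 u) //= big1 ?addr0 ?mulr1 => [|x]; last by rewrite (all1 x u) eqxx.
  by rewrite (all1 u v) eqxx.
apply: (givens_extend py outy to_y to_p); apply: IH ec'.
rewrite card_sig (leq_trans _ cV) //; apply: proper_card; apply/properP.
by split; [apply/subsetP|exists y; rewrite !inE ?eqxx].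
Qed.

Lemma caterpillar_allows (V : finType) (D : rel V) :
  irreflexive D -> extended_caterpillar D -> allows_symplectic_pairs R D.
Proof.
move=> irr /caterpillar_orthogonal[a [apos asupp aorth]].
apply: (@allows_of_matrices R V D (fun u v => - a u v) (fun u v => - a u v)) => //.
- by move=> u; rewrite oppr_lt0.
- by move=> u v; rewrite oppr_eq0.
- by move=> u v; rewrite -aorth; apply: eq_bigr => x _; rewrite mulrNN.
Qed.

(** A weighing matrix [M] of order 4 and weight 3 satisfies [M (M / 3)^T = 1]. *)
Lemma weighing_allows (V : finType) (D : rel V) (E : rel 'I_4) (M : 'I_4 -> 'I_4 -> int) :
  irreflexive D -> digraph_iso D E -> (forall i, M i i = -1) ->
  (forall i j, (M i j != 0) = (i == j) || E i j) ->
  (forall i j, \sum_k M i k * M j k = if i == j then 3 else 0) ->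
  allows_symplectic_pairs R D.
Proof.
move=> irr [f bf fE] Mii ME MM; have injf := bij_inj bf.
apply: (@allows_of_matrices R V D (fun u v => (M (f u) (f v))%:~R)
   (fun u v => (M (f u) (f v))%:~R / 3)) => //.
- by move=> u; rewrite Mii ltrz0.
- by move=> u v; rewrite intr_eq0 ME fE (inj_eq injf).
- move=> u v; rewrite sgzM; have -> : sgz (3^-1 : R) = 1.
    by apply: gtr0_sgz; rewrite invr_gt0 ltr0n.
  by rewrite mulr1.
move=> u v; have := congr1 (fun z : int => z%:~R / 3 : R) (MM (f u) (f v)).
rewrite rmorph_sum /= mulr_suml (inj_eq injf) (reindex f) /=; last exact: onW_bij.
under eq_bigr do rewrite intrM -mulrA.
by move=> ->; case: ifP => _; rewrite ?mul0r // -pmulrn divff // pnatr_eq0.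
Qed.

End Givens.

(** * The two exceptional digraphs *)
Section FourVertices.

Definition weighing_W4 (i j : 'I_4) : int := nth 0%R (nth [::]
  [:: [:: -1; 1; 1; 0]; [:: 0; -1; 1; 1]; [:: -1; 0; -1; 1]; [:: -1; -1; 0; -1]]%R i) j.

Definition weighing_C4 (i j : 'I_4) : int := nth 0%R (nth [::]
  [:: [:: -1; 1; 0; 1]; [:: -1; -1; 1; 0]; [:: 0; -1; -1; 1]; [:: -1; 0; -1; -1]]%R i) j.

Lemma W4_allows (R : realType) (V : finType) (D : rel V) :
  irreflexive D -> digraph_iso D W4 -> allows_symplectic_pairs R D.
Proof.
move=> irr iso; apply: (@weighing_allows R V D W4 weighing_W4 irr iso).
- by move=> [[|[|[|[|//]]]] ?].
- by move=> [[|[|[|[|//]]]] ?] [[|[|[|[|//]]]] ?].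
- by move=> [[|[|[|[|//]]]] ?] [[|[|[|[|//]]]] ?]; rewrite !big_ord_recl big_ord0.
Qed.

Lemma C4_allows (R : realType) (V : finType) (D : rel V) :
  irreflexive D -> digraph_iso D (star C4) -> allows_symplectic_pairs R D.
Proof.
move=> irr iso; apply: (@weighing_allows R V D (star C4) weighing_C4 irr iso).
- by move=> [[|[|[|[|//]]]] ?].
- by move=> [[|[|[|[|//]]]] ?] [[|[|[|[|//]]]] ?].
- by move=> [[|[|[|[|//]]]] ?] [[|[|[|[|//]]]] ?]; rewrite !big_ord_recl big_ord0.
Qed.

Lemma iso_of_seq (V : finType) (D : rel V) (E : rel 'I_4) x0 (s : seq V) :
  uniq s -> size s = 4 -> (forall u, u \in s) ->
  (forall i j : 'I_4, D (nth x0 s i) (nth x0 s j) = E i j) -> digraph_iso D E.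
Proof.
move=> Us s4 sall DE.
have lt4 u : index u s < 4 by rewrite -s4 index_mem.
exists (fun u => Ordinal (lt4 u)).
  exists (fun i : 'I_4 => nth x0 s i) => [u|i]; first by rewrite /= nth_index.
  by apply: val_inj; rewrite /= index_uniq // s4.
by move=> u v; rewrite -DE /= !nth_index.
Qed.

Lemma W4_like_iso (V : finType) (D : rel V) : W4_like D -> digraph_iso D W4.
Proof.
move=> [y [m [p [z [U all4 [Ey Em Ep Ez]]]]]].
apply: (iso_of_seq (x0 := y) U) => //.
have {}Ey u : D y u = (u \in [:: m; p]) := Ey u.
have {}Em u : D m u = (u \in [:: p; z]) := Em u.
have {}Ep u : D p u = (u \in [:: z; y]) := Ep u.
have {}Ez u : D z u = (u \in [:: y; m]) := Ez u.
move: U; rewrite /= !inE !negb_or => /and4P[/and3P[ym yp yz] /andP[mp mz] pz _].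
have sym (u v : V) : u != v -> (v == u) = false by rewrite eq_sym => /negbTE.
have ne := (negbTE ym, negbTE yp, negbTE yz, negbTE mp, negbTE mz, negbTE pz,
  sym _ _ ym, sym _ _ yp, sym _ _ yz, sym _ _ mp, sym _ _ mz, sym _ _ pz).
by move=> [[|[|[|[|//]]]] ?] [[|[|[|[|//]]]] ?]; rewrite /= ?Ey ?Em ?Ep ?Ez /W4 !inE ?eqxx ?ne ?orbT.
Qed.

Lemma C4_like_iso (V : finType) (D : rel V) : C4_like D -> digraph_iso D (star C4).
Proof.
move=> [y [m [p [z [U all4 [Ey Em Ep Ez]]]]]].
apply: (iso_of_seq (x0 := y) U) => //.
have {}Ey u : D y u = (u \in [:: m; z]) := Ey u.
have {}Em u : D m u = (u \in [:: y; p]) := Em u.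
have {}Ep u : D p u = (u \in [:: m; z]) := Ep u.
have {}Ez u : D z u = (u \in [:: y; p]) := Ez u.
move: U; rewrite /= !inE !negb_or => /and4P[/and3P[ym yp yz] /andP[mp mz] pz _].
have sym (u v : V) : u != v -> (v == u) = false by rewrite eq_sym => /negbTE.
have ne := (negbTE ym, negbTE yp, negbTE yz, negbTE mp, negbTE mz, negbTE pz,
  sym _ _ ym, sym _ _ yp, sym _ _ yz, sym _ _ mp, sym _ _ mz, sym _ _ pz).
by move=> [[|[|[|[|//]]]] ?] [[|[|[|[|//]]]] ?]; rewrite /= ?Ey ?Em ?Ep ?Ez !inE ?eqxx ?ne ?orbT.
Qed.

Lemma iso_not_all_in (V : finType) (D : rel V) (E : rel 'I_4) p : digraph_iso D E ->
  (forall j, exists2 i, i != j & ~~ E i j) -> ~ forall v, v != p -> D v p.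
Proof.
move=> [f [g gK fK] fE] noE to_p; have [i ij] := noE (f p).
have := to_p (g i); rewrite -fE fK => ->; first by [].
by apply: contra ij => /eqP<-; rewrite fK.
Qed.

Lemma W4_not_all_in j : exists2 i, i != j & ~~ W4 i j.
Proof.
by case: j => [[|[|[|[|//]]]] ?]; [exists (inord 1)|exists (inord 2)|exists (inord 3)|exists (inord 0)];
  rewrite -?val_eqE /W4 /= ?inordK.
Qed.

Lemma C4_not_all_in j : exists2 i, i != j & ~~ star C4 i j.
Proof.
by case: j => [[|[|[|[|//]]]] ?]; [exists (inord 2)|exists (inord 3)|exists (inord 0)|exists (inord 1)];
  rewrite /star /C4 -?val_eqE /= ?inordK.
Qed.

End FourVertices.

(** * The classification *)
Lemma singleton_caterpillar (V : finType) (D : rel V) (x : V) :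
  irreflexive D -> (forall u, u = x) -> extended_caterpillar D.
Proof.
move=> irr all1; apply/extended_caterpillarP.
exists 1, (fun _ => x), (fun _ => 0), (fun _ _ => false).
have noleaf u : leaf (fun _ => x) (fun _ => 0) u = false by rewrite /leaf (all1 u) eqxx.
split; first split=> //.
- by case.
- by move=> u; rewrite noleaf.
- by split=> // u v; rewrite noleaf.
by move=> u v; rewrite (all1 u) (all1 v) irr /caterpillar_arc noleaf.
Qed.

(** Without vertices of outdegree 1 the digraph is exceptional; otherwise such a vertex
    [y] can be deleted. The rest is not exceptional, because [p] is an out-neighbour of
    all its other vertices. *)
Lemma biorthogonal_classification (R : realType) n (V : finType) (D : rel V) (x : V) :
  #|V| <= n -> irreflexive D -> strong D -> noneven D -> (forall u, near D u) ->
  (exists a b, @biorthogonal R V D a b) ->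
  [\/ digraph_iso D W4, digraph_iso D (star C4) | extended_caterpillar D].
Proof.
elim: n V D x => [|n IH] V D x cV irr sD nD near_D [a [b ab]].
  by move: cV; rewrite leqn0 => /eqP/card0_eq/(_ x).
have [D_out2|[y [p outy']]] := out2_dec D.
  have [/W4_like_iso|/C4_like_iso] := out2_exceptions (leqnn _) irr sD nD (fun u (_ : u != x) => near_D u) D_out2.
    by constructor 1.
  by constructor 2.
have [[u uy]|all1] : (exists u, u != y) \/ forall u, u = y.
  have [/existsP|/existsPn H] := boolP [exists u, u != y]; [by left|right=> u].
  by have := H u; rewrite negbK => /eqP.
2: by constructor 3; exact: (singleton_caterpillar irr all1).
have yp : D y p.
  have /connectP[[|v s] /= Ps lu] := sD y u; first by rewrite lu eqxx in uy.
  by case/andP: Ps => yv _; rewrite -(outy' v yv).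
have outy v : D y v = (v == p) by apply/idP/eqP => [/outy'|->].
have [inE_ [a' [b' ab']]] := biorthogonal_delete irr outy ab.
have py : p != y by apply: contraTneq yp => ->; rewrite irr.
have to_y v : v != y -> D v y.
  move=> vy; have [->|vp] := eqVneq v p; first by rewrite inE_ // eqxx.
  apply: (near_adjacent (near_D y) vy); last by rewrite outy.
  by move=> c c'; rewrite !inE !outy => /andP[/eqP-> _] /andP[/eqP-> _].
have to_p v : v != y -> v != p -> D v p.
  by move=> vy vp; have := inE_ v vy; rewrite to_y // (negbTE vp) => /esym.
have pW : p \in [set~ y] by rewrite !inE.
have all_in (v : {v | v \in [set~ y]}) : v != exist _ p pW -> delete D y v (exist _ p pW).
  rewrite -val_eqE => vp; apply: to_p => //.
  by have := valP v; rewrite !inE.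
have card_del : #|{: {v | v \in [set~ y]}}| <= n.
  rewrite card_sig -ltnS (leq_trans _ cV) //; apply: proper_card; apply/properP.
  by split; [apply/subsetP|exists y; rewrite !inE ?eqxx].
have irr_del : irreflexive (delete D y) by move=> v; rewrite /delete irr.
have via v : D v y -> v != p -> D v p.
  by move=> vy vp; apply: to_p => //; exact: irreflexive_neq irr vy.
have nD_del : noneven (delete D y) by apply: (noneven_inj val_inj) nD.
have [] := IH _ _ (exist _ p pW) card_del irr_del (delete_strong irr sD outy via) nD_del
  (delete_near outy to_y to_p near_D) (ex_intro _ a' (ex_intro _ b' ab')).
- by move/iso_not_all_in => /(_ _ W4_not_all_in all_in).
- by move/iso_not_all_in => /(_ _ C4_not_all_in all_in).
- by constructor 3; exact: (caterpillar_extend irr outy to_y to_p).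
Qed.

Theorem theorem6p3 (R : realType) (V : finType) (D : rel V)
    (V_nonempty : 0 < #|V|) (D_loopless : irreflexive D)
    (D_strong : strong D) (D_dense : dense_digraph D) (D_noneven : noneven D) :
  allows_symplectic_pairs R D <->
  [\/ digraph_iso D W4, digraph_iso D (star C4) | extended_caterpillar D].
Proof.
split=> [sp|[]]; last 1 first.
- exact: caterpillar_allows.
- case/card_gt0P: V_nonempty => x _.
  apply: (biorthogonal_classification x (leqnn _) D_loopless D_strong D_noneven).
    exact: dense_near.
  exact: biorthogonal_of_allows sp.
- exact: W4_allows.
- exact: C4_allows.
Qed.
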